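(* Let $f(z)=a_0/z+O(z^{-2})$, $a_0>0$, be a positive algebraic germ at infinity with irreducible defining polynomial $P(z,w)=\sum_{j=0}^dp_j(z)w^j$, $d=\deg_wP$, let $K\subset\mathbb C$ be compact and convex, and let $L\subset\mathbb C\setminus p_d^{-1}(0)$ be compact. There exist $C_1,C_2,r_0>0$, depending only on $P$, $L$ and $K$, such that $$\mu(D(a,r))\le C_1r+\frac{C_2}{r}\,\mathfrak D_{P,K}(\mu)$$ for all $\mu\in\mathcal M_f(K)$, $a\in L$ and $0<r\le r_0$. Consequently, a measure $\mu\in\mathcal M_f(K)$ with $\mathfrak D_{P,K}(\mu)=0$ has linear growth on $L$ (that is, $\mu(D(a,r))\le C_1 r$ for all $a\in L$, $0<r\le r_0$) and has no atoms in $L$. If $\mu\in\mathcal M_f(K)$ has an atom of mass $m$ at a point of $L$, then $$\mathfrak D_{P,K}(\mu)\ge c_{\rm at}m^2$$ for a constant $c_{\rm at}>0$ depending only on $P$, $L$, $K$ and $a_0$.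
   Context: $dA$ is planar Lebesgue measure; $D(a,r)=\{z\in\mathbb C:|z-a|<r\}$. For a finite compactly supported complex Borel measure $\mu$ on $\mathbb C$, its Cauchy transform is $\mathcal C_\mu(z)=\int_{\mathbb C}\frac{d\mu(\zeta)}{z-\zeta}$ (defined for almost every $z$, in $L^1_{\mathrm{loc}}(\mathbb C)$). A positive algebraic germ is an analytic germ at infinity $f(z)=\frac{a_0}{z}+O(z^{-2})$ with $a_0>0$ that is algebraic. Its irreducible defining polynomial is the irreducible $P(z,w)=\sum_{j=0}^d p_j(z)w^j\in\mathbb C[z,w]$, $d=\deg_wP\ge1$, $p_d\not\equiv0$, with $P(z,f(z))=0$ near infinity (unique up to a nonzero constant). $\mathcal M_f(K)$ is the set of positive measures supported in $K$ whose Cauchy transform has germ $f$ at infinity. For such $\mu$, $$\mathfrak D_{P,K}(\mu)=\int_K\left|P\bigl(z,\mathcal C_\mu(z)\bigr)\right|^{1/d}\,dA(z).$$ *)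

(* Defs.v *)
From HB Require Import structures.
From mathcomp Require Import all_boot all_order all_algebra.
From mathcomp Require Import all_classical all_reals all_analysis.
From mathcomp Require Export complex.
Import Order.TTheory GRing.Theory Num.Theory.
Import numFieldNormedType.Exports.

Set Implicit Arguments.
Unset Strict Implicit.
Unset Printing Implicit Defensive.

Local Open Scope classical_set_scope.
Local Open Scope ring_scope.

(* The complex plane is used in two guises: the field [R[i]], in which the
   values and the polynomials live, and the Borel space [plane R] of real
   coordinate pairs, on which the measures live; [cplx] identifies them.
   [measurableTypeR R] is [R] with its Borel sets. *)
Definition plane (R : realType) := (measurableTypeR R * measurableTypeR R)%type.

Definition cplx (R : realType) (z : plane R) : R[i] := (z.1 +i* z.2)%C.

Definition cabs (R : realType) (w : R[i]) : R := ComplexField.Normc.normc w.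

Definition disc (R : realType) (a : plane R) (r : R) : set (plane R) :=
  [set z | cabs (cplx z - cplx a) < r].

Definition compact_plane (R : realType) (K : set (plane R)) : Prop :=
  compact (K : set (R * R)%type).

Definition convex_plane (R : realType) (K : set (plane R)) : Prop :=
  @convex_set R (R^o * R^o)%type K.

Definition planar_lebesgue (R : realType) :
    {measure set (plane R) -> \bar R} :=
  (@lebesgue_measure R \x @lebesgue_measure R)%E.

(* Integration of a complex function, by real and imaginary parts. *)
Definition cintegral (R : realType) (mu : {measure set (plane R) -> \bar R})
    (f : plane R -> R[i]) : R[i] :=
  (Rintegral mu setT (fun x => complex.Re (f x)) +i*
   Rintegral mu setT (fun x => complex.Im (f x)))%C.

Definition cauchy_transform (R : realType) (mu : {measure set (plane R) -> \bar R})
    (z : plane R) : R[i] :=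
  cintegral mu (fun zeta => (cplx z - cplx zeta)^-1).

Definition near_infinity (R : realType) (Q : R[i] -> Prop) : Prop :=
  exists rho : R, forall z : R[i], rho < cabs z -> Q z.

(* Germs at infinity are handled through representatives [f : R[i] -> R[i]], of
   which only the values near infinity matter. *)
Definition analytic_at_infinity (R : realType) (f : R[i] -> R[i]) : Prop :=
  exists c : nat -> R[i], near_infinity (fun z =>
    series (fun n => c n * z^-1 ^+ n : R[i]^o) @ \oo --> (f z : R[i]^o)).

Definition leading_at_infinity (R : realType) (f : R[i] -> R[i]) (a0 : R) :
    Prop :=
  exists M : R, near_infinity (fun z =>
    cabs (f z - a0%:C%C / z) <= M / cabs z ^+ 2).

(* A polynomial P(z,w) = \sum_j p_j(z) w^j is an element of
   [{poly {poly R[i]}}]: the outer variable is w, and [P`_j] is p_j. *)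
Definition eval_zw (R : realType) (P : {poly {poly R[i]}}) (z w : R[i]) : R[i] :=
  P.[w%:P].[z].

Definition deg_w (R : realType) (P : {poly {poly R[i]}}) : nat := (size P).-1.

(* Irreducibility in the ring C[z,w]. The library's [irreducible_poly] is meant
   for coefficients in a field: over C[z] it would ignore factors lying in
   C[z]. *)
Definition irreducible_zw (R : realType) (P : {poly {poly R[i]}}) : Prop :=
  [/\ P != 0, P \isn't a GRing.unit &
      forall Q S : {poly {poly R[i]}}, P = Q * S ->
        Q \is a GRing.unit \/ S \is a GRing.unit].

(* [f] represents a positive algebraic germ a_0/z + O(z^-2) which is a branch of
   P(z,w) = 0; when [P] is irreducible it is the defining polynomial of [f]. *)
Definition positive_algebraic_germ (R : realType) (f : R[i] -> R[i]) (a0 : R)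
    (P : {poly {poly R[i]}}) : Prop :=
  [/\ analytic_at_infinity f, 0 < a0, leading_at_infinity f a0 &
      near_infinity (fun z => eval_zw P z (f z) = 0)].

Definition germ_measures (R : realType) (f : R[i] -> R[i]) (K : set (plane R))
    (mu : {finite_measure set (plane R) -> \bar R}) : Prop :=
  mu (~` K) = 0%E /\
  exists rho : R, forall z : plane R, rho < cabs (cplx z) ->
    cauchy_transform mu z = f (cplx z).

(* Extended-real valued; [`^] is the real power. *)
Definition defect (R : realType) (P : {poly {poly R[i]}}) (K : set (plane R))
    (mu : {measure set (plane R) -> \bar R}) : \bar R :=
  (\int[@planar_lebesgue R]_(z in K)
     ((cabs (eval_zw P (cplx z) (cauchy_transform mu z)))
        `^ ((deg_w P)%:R^-1))%:E)%E.

(* Main.v *)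
(** The disc of radius [r] about [a] is cut off by the polynomial bump
    [chi(x,y) = (1 - ((x-a1)/s)^2) (1 - ((y-a2)/s)^2)] on the square of half-side
    [s = 4r], which vanishes on the boundary of the square. Integrating
    [grad chi . (z-w)/(|z-w|^2+e)] by parts over the square produces the positive
    kernel [2e/(|z-w|^2+e)^2], of mass bounded below as [e] tends to 0, so that
    [- int grad chi(z) . grad log |z-w| dA(z)] is nonnegative in [w] and at least
    [1/2] on the disc. Integrating against [mu] and applying Fubini bounds
    [mu(D(a,r))] by [C/r] times the integral of [|C_mu|] over the square. Since
    [|p_d|] is bounded below near [L], [|C_mu| <= A (1 + |P(z,C_mu)|^(1/d))] there,
    and [P(z,C_mu)] vanishes off [K]: a point outside the convex set [K] lies in
    a disc free of [K] whose centre is far away, where [C_mu = f]; on that disc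
    [P(z,C_mu)] is a power series which vanishes near the centre. The bound on atoms
    follows by taking [r] proportional to the mass [m] of the atom, which is allowed
    because [m <= mu(K) <= a_0]. *)

Require Import Defs.
From HB Require Import structures.
From mathcomp Require Import all_boot all_order all_algebra.
From mathcomp Require Import all_classical all_reals all_analysis.
From mathcomp Require Import measurable_realfun.
From mathcomp Require Import ring lra.
Import Order.TTheory GRing.Theory Num.Theory.
Import numFieldNormedType.Exports.
Local Open Scope classical_set_scope.
Local Open Scope ring_scope.

Set Implicit Arguments.
Unset Strict Implicit.
Unset Printing Implicit Defensive.

(** The obstacle is the singularity of [1/(z-w)]: the gradient of [log |z-w|] is not differentiable
    at [w], and the Cauchy transform is a genuine integral only for almost every [z]. The parameter
    [e] makes the integration by parts legitimate, and a bound of the kernel by a multiple of the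
    inverse distance, uniform in [e >= 0], serves both the limit under the integral and Fubini. A
    product of two parabolas is taken as bump because each partial derivative then integrates to
    zero along lines by the one-variable fundamental theorem of calculus; no Green formula is
    needed. With [e = r^2] the mass seen on the square of half-side [r] about [w] is at least 1/2 at
    every scale. The linear term in the growth bound is the area, of order [r^2], times the slope of
    the bump, of order [1/r]. Convexity lets a single disc join an outside point to a neighbourhood
    of infinity, so that no chain of continuations occurs. The growth constants see only bounds on
    the coefficients of [P] near [L]; the number [a0] enters through the cap on the total mass
    alone. *)

Arguments cabs : simpl never.

(** * The modulus and polynomial bounds *)

Section Modulus.
Variable R : realType.
Implicit Types x y z w : R[i].

Lemma cabsE (a b : R) : cabs (a +i* b)%C = Num.sqrt (a ^+ 2 + b ^+ 2).
Proof. by []. Qed.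

Lemma cabs_ge0 x : 0 <= cabs x.
Proof. by case: x => a b; rewrite cabsE sqrtr_ge0. Qed.

Lemma cabs0 : cabs (0 : R[i]) = 0.
Proof. exact: ComplexField.Normc.normc0. Qed.

Lemma cabs1 : cabs (1 : R[i]) = 1.
Proof. exact: ComplexField.Normc.normc1. Qed.

Lemma cabsM x y : cabs (x * y) = cabs x * cabs y.
Proof. exact: ComplexField.Normc.normcM. Qed.

Lemma cabsV x : cabs x^-1 = (cabs x)^-1.
Proof. exact: ComplexField.Normc.normcV. Qed.

Lemma cabsN x : cabs (- x) = cabs x.
Proof. by case: x => a b; rewrite /cabs /= !sqrrN. Qed.

Lemma cabsX x n : cabs (x ^+ n) = cabs x ^+ n.
Proof. by elim: n => [|n IH]; rewrite ?expr0 ?cabs1// !exprS cabsM IH. Qed.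

Lemma cabs_eq0 x : (cabs x == 0) = (x == 0).
Proof.
by apply/eqP/eqP => [|->]; [exact: ComplexField.Normc.eq0_normc | exact: cabs0].
Qed.

Lemma cabs_gt0 x : (0 < cabs x) = (x != 0).
Proof. by rewrite lt_def cabs_ge0 andbT cabs_eq0. Qed.

Lemma ler_cabsD x y : cabs (x + y) <= cabs x + cabs y.
Proof. exact: le_normcD. Qed.

Lemma cabsBC x y : cabs (x - y) = cabs (y - x).
Proof. by rewrite -cabsN opprB. Qed.

Lemma ler_cabs_distD z x y : cabs (x - y) <= cabs (x - z) + cabs (z - y).
Proof. by rewrite -[x - y](subrKA z) ler_cabsD. Qed.

Lemma lerB_cabs x y : cabs x - cabs y <= cabs (x - y).
Proof. by rewrite lerBlDr -{1}[x](subrK y) ler_cabsD. Qed.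

Lemma cabs_real (a : R) : cabs a%:C%C = `|a|.
Proof. by rewrite cabsE expr0n addr0 sqrtr_sqr. Qed.

Lemma sqr_cabs x : cabs x ^+ 2 = complex.Re x ^+ 2 + complex.Im x ^+ 2.
Proof. by case: x => a b; rewrite cabsE /= sqr_sqrtr// addr_ge0// sqr_ge0. Qed.

Lemma Re_le_cabs x : `|complex.Re x| <= cabs x.
Proof.
rewrite -(@ler_pXn2r _ 2)// ?nnegrE ?cabs_ge0// sqr_cabs real_normK ?num_real//.
by rewrite lerDl sqr_ge0.
Qed.

Lemma Im_le_cabs x : `|complex.Im x| <= cabs x.
Proof.
rewrite -(@ler_pXn2r _ 2)// ?nnegrE ?cabs_ge0// sqr_cabs real_normK ?num_real//.
by rewrite lerDr sqr_ge0.
Qed.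

Lemma cabs_le_ReIm x : cabs x <= `|complex.Re x| + `|complex.Im x|.
Proof.
rewrite -(@ler_pXn2r _ 2)// ?nnegrE ?cabs_ge0 ?addr_ge0// sqr_cabs sqrrD.
rewrite !real_normK ?num_real// -addrA lerD2l lerDr mulrn_wge0//.
Qed.

Lemma cabs_sum (I : Type) (s : seq I) (Q : pred I) (F : I -> R[i]) :
  cabs (\sum_(i <- s | Q i) F i) <= \sum_(i <- s | Q i) cabs (F i).
Proof.
elim/big_ind2: _ => [|x a y b xa yb|//]; first by rewrite cabs0.
by rewrite (le_trans (ler_cabsD _ _))// lerD.
Qed.

End Modulus.

Section PolynomialBounds.
Variable R : realType.
Implicit Types (q : {poly R[i]}) (P : {poly {poly R[i]}}).

(** Both bounds go through one Horner induction, because the Lipschitz estimate for [q * 'X + c]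
    uses the size of [q]. *)
Lemma poly_bounded_lipschitz q (M : R) : 0 <= M -> exists B : R, [/\ 0 < B,
  (forall z, cabs z <= M -> cabs q.[z] <= B) &
  (forall z w, cabs z <= M -> cabs w <= M ->
     cabs (q.[z] - q.[w]) <= B * cabs (z - w))].
Proof.
move=> M0; elim/poly_ind: q => [|q c [B [B0 qB qL]]].
  exists 1; split=> // [z _|z w _ _]; rewrite !horner0 ?cabs0// subrr cabs0.
  by rewrite mul1r cabs_ge0.
exists (B * M + B + cabs c); split=> [|z zM|z w zM wM].
- by rewrite ltr_pwDl ?cabs_ge0// ltr_wpDl// mulr_ge0// ltW.
- rewrite hornerMXaddC (le_trans (ler_cabsD _ _))// lerD2r cabsM.
  by rewrite ler_wpDr ?(ltW B0)// ler_pM ?cabs_ge0// qB.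
- rewrite !hornerMXaddC.
  have -> : q.[z] * z + c - (q.[w] * w + c) =
    (q.[z] - q.[w]) * z + q.[w] * (z - w) by ring.
  rewrite (le_trans (ler_cabsD _ _))// !cabsM.
  have h1 := qL z w zM wM; have h2 := qB w wM.
  have d0 := cabs_ge0 (z - w); have c0 := cabs_ge0 c.
  rewrite !mulrDl -addrA lerD//; last first.
    by rewrite ler_wpDr ?mulr_ge0// ler_wpM2r.
  by rewrite mulrAC ler_pM ?cabs_ge0.
Qed.

Lemma eval_zw0 (z w : R[i]) : eval_zw 0 z w = 0.
Proof. by rewrite /eval_zw !horner0. Qed.

Lemma eval_zwMXaddC P q (z w : R[i]) :
  eval_zw (P * 'X + q%:P) z w = eval_zw P z w * w + q.[z].
Proof. by rewrite /eval_zw hornerMXaddC !hornerE. Qed.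

Lemma eval_zwE P (z w : R[i]) :
  eval_zw P z w = \sum_(j < size P) (P`_j).[z] * w ^+ j.
Proof.
rewrite /eval_zw (horner_coef P) [LHS](raddf_sum (horner_eval z)); apply: eq_bigr => j _.
by rewrite /= /horner_eval hornerM horner_exp hornerC.
Qed.

Lemma coefs_bounded P (M : R) : 0 <= M -> exists B : R, 0 < B /\
  forall j z, cabs z <= M -> cabs (P`_j).[z] <= B.
Proof.
move=> M0; elim/poly_ind: P => [|P q [B [B0 PB]]].
  by exists 1; split=> // j z _; rewrite coef0 horner0 cabs0.
have [B' [B'0 qB _]] := poly_bounded_lipschitz q M0.
exists (B + B'); split=> [|j z zM]; first exact: addr_gt0.
rewrite coefD coefMX coefC; case: j => [|j] /=.
  by rewrite add0r (le_trans (qB _ zM))// lerDr ltW.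
by rewrite addr0 (le_trans (PB _ _ zM))// lerDl ltW.
Qed.

(** Either [w] is below the threshold [1 + 2dB/c], or the lower-order terms are at most half of the
    leading one, so that [|w|^d] is at most [2/c] times [|P(z,w)|]. *)
Lemma root_power_bound P (z w : R[i]) (c B : R) : (1 <= deg_w P)%N ->
  0 < c -> 0 < B -> c <= cabs (P`_(deg_w P)).[z] ->
  (forall j, cabs (P`_j).[z] <= B) ->
  cabs w <= (1 + 2 * (deg_w P)%:R * B / c + 2 / c) *
    (1 + cabs (eval_zw P z w) `^ (deg_w P)%:R^-1).
Proof.
move=> d1 c0 B0 cP PB; set d := deg_w P in d1 cP *.
have d0 : 0 < d%:R :> R by rewrite ltr0n.
set A0 := 1 + _; set X := _ `^ _.
have X0 : 0 <= X by exact: powR_ge0.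
have A01 : 1 <= A0 by rewrite lerDl divr_ge0 ?mulr_ge0// ltW.
have c2 : 0 <= 2 / c by rewrite divr_ge0// ltW.
have [wA|Aw] := leP (cabs w) A0.
  rewrite (le_trans wA)// -[leLHS]mulr1 ler_pM//; lra.
have w1 : 1 <= cabs w by lra.
have sP : size P = d.+1.
  by move: d1; rewrite /d /deg_w; case: (size P).
have eP : eval_zw P z w = \sum_(j < d) (P`_j).[z] * w ^+ j + (P`_d).[z] * w ^+ d.
  by rewrite eval_zwE sP big_ord_recr.
have lowS : cabs (\sum_(j < d) (P`_j).[z] * w ^+ j) <= d%:R * B * cabs w ^+ d.-1.
  rewrite (le_trans (cabs_sum _ _ _))//.
  rewrite (@le_trans _ _ (\sum_(j < d) B * cabs w ^+ d.-1))//; last first.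
    by rewrite sumr_const card_ord -mulrA mulr_natl.
  apply: ler_sum => j _; rewrite cabsM cabsX ler_pM ?exprn_ge0 ?cabs_ge0//.
  by rewrite ler_weXn2l// -ltnS prednK.
have wd : d%:R * B * cabs w ^+ d.-1 <= c / 2 * cabs w ^+ d.
  rewrite -[in leRHS](prednK d1) exprS mulrA ler_wpM2r ?exprn_ge0 ?cabs_ge0//.
  have : 2 * d%:R * B / c <= cabs w by rewrite (le_trans _ (ltW Aw))// lerDr.
  by rewrite ler_pdivrMr//; move: (cabs w) => s; clear; lra.
have key : cabs w ^+ d <= 2 / c * cabs (eval_zw P z w).
  rewrite mulrAC ler_pdivlMr// [leLHS]mulrC.
  have := lerB_cabs ((P`_d).[z] * w ^+ d) (- \sum_(j < d) (P`_j).[z] * w ^+ j).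
  rewrite opprK cabsN addrC [_ + \sum_(_ < _) _]addrC -eP cabsM cabsX => h.
  have h2 : c * cabs w ^+ d <= cabs (P`_d).[z] * cabs w ^+ d.
    by rewrite ler_wpM2r// exprn_ge0// cabs_ge0.
  move: h h2 wd lowS; clear; move: (cabs _) (cabs _ ^+ d) (cabs _ * _) => *; lra.
have -> : cabs w = (cabs w ^+ d) `^ d%:R^-1.
  rewrite -powR_mulrn ?cabs_ge0// -powRrM mulfV ?gt_eqF//.
  by rewrite powRr1// cabs_ge0.
have : (cabs w ^+ d) `^ d%:R^-1 <= (2 / c * cabs (eval_zw P z w)) `^ d%:R^-1.
  rewrite ge0_ler_powR ?invr_ge0 ?ler0n// nnegrE ?exprn_ge0 ?cabs_ge0//.
  by rewrite mulr_ge0 ?cabs_ge0.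
move/le_trans; apply; rewrite powRM ?cabs_ge0//.
(* Enlarging the base to one that is at least 1 makes its [d]-th root no larger than itself, whether
   or not [2/c] exceeds 1. *)
have : (2 / c) `^ d%:R^-1 <= 1 + 2 / c.
  rewrite (@le_trans _ _ ((1 + 2 / c) `^ d%:R^-1))//.
    by rewrite ge0_ler_powR ?invr_ge0 ?ler0n ?nnegrE ?addr_ge0 ?lerDr.
  rewrite -[leRHS]powRr1 ?addr_ge0// ler_powR ?lerDl//.
  by rewrite invf_le1// ler1n.
rewrite -/X => h.
rewrite (@le_trans _ _ ((1 + 2 / c) * X))// ?ler_wpM2r//.
by rewrite ler_pM ?addr_ge0 ?lerD ?lerDr.
Qed.

End PolynomialBounds.

(** * Power series *)

Section PowerExpansion.
Variables (R : realType) (rho : R).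
Hypothesis rho0 : 0 < rho.
Implicit Types (g h : R[i] -> R[i]) (a b : nat -> R[i]).

(* [g] is the sum of an absolutely convergent power series on the closed disc
   of radius [rho] about 0. *)
Definition power_expansion g := exists (a : nat -> R[i]) (M : R), [/\ 0 <= M,
  forall N, \sum_(n < N) cabs (a n) * rho ^+ n <= M &
  forall t N, cabs t <= rho ->
    cabs (g t - \sum_(n < N) a n * t ^+ n) <= M * (cabs t / rho) ^+ N].

Lemma power_expansion_cst (k : R[i]) : power_expansion (fun=> k).
Proof.
exists (fun n => if n == 0%N then k else 0), (cabs k); split=> [|[|N]|t [|N] tr].
- exact: cabs_ge0.
- by rewrite big_ord0 cabs_ge0.
- rewrite big_ord_recl/= expr0 mulr1 big1 ?addr0// => i _.
  by rewrite cabs0 mul0r.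
- by rewrite big_ord0 subr0 expr0 mulr1.
- rewrite big_ord_recl/= expr0 mulr1 big1 ?addr0 ?subrr ?cabs0.
    by rewrite mulr_ge0 ?exprn_ge0 ?divr_ge0 ?cabs_ge0// ltW.
  by move=> i _; rewrite mul0r.
Qed.

Lemma power_expansion_id : power_expansion (fun t => t).
Proof.
exists (fun n => if n == 1%N then 1 else 0), rho.
split=> [|[|[|N]]|t [|[|N]] tr].
- exact: ltW.
- by rewrite big_ord0 ltW.
- by rewrite big_ord_recl big_ord0 /= cabs0 mul0r addr0 ltW.
- rewrite !big_ord_recl/= cabs0 mul0r add0r cabs1 mul1r expr1 big1 ?addr0//.
  by move=> i _; rewrite mul0r.
- by rewrite big_ord0 subr0 expr0 mulr1.
- rewrite big_ord_recl big_ord0 /= mul0r addr0 subr0 expr1 mulrC divfK//.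
  by rewrite gt_eqF.
- rewrite !big_ord_recl/= mul0r add0r mul1r expr1 big1 ?addr0 ?subrr ?cabs0.
    by rewrite mulr_ge0 ?exprn_ge0 ?divr_ge0 ?cabs_ge0// ltW.
  by move=> i _; rewrite mul0r.
Qed.

Lemma power_expansionD g h : power_expansion g -> power_expansion h ->
  power_expansion (fun t => g t + h t).
Proof.
move=> [a [M [M0 aM gM]]] [b [M' [M'0 bM hM]]].
exists (fun n => a n + b n), (M + M'); split=> [|N|t N tr].
- exact: addr_ge0.
- rewrite (le_trans _ (lerD (aM N) (bM N)))// -big_split/= ler_sum// => i _.
  by rewrite -mulrDl ler_wpM2r ?ler_cabsD// exprn_ge0// ltW.
- under eq_bigr do rewrite mulrDl.
  rewrite big_split/= opprD addrACA mulrDl.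
  by rewrite (le_trans (ler_cabsD _ _))// lerD ?gM ?hM.
Qed.

Let coefM_trunc a b N n : (n < N)%N ->
  ((\poly_(i < N) a i) * (\poly_(i < N) b i))`_n =
  \sum_(i < n.+1) a i * b (n - i)%N.
Proof.
move=> nN; rewrite coefM; apply: eq_bigr => i _; rewrite !coef_poly.
by rewrite (leq_ltn_trans _ nN) ?(leq_ltn_trans _ nN) ?leq_subr// -ltnS.
Qed.

(** Cauchy product. The factor 3 counts the errors: the tail of [g] times [h], a partial sum of [g]
    times the tail of [h], and the terms of index at least [N] in the product of the two
    truncations. *)
Lemma power_expansionM g h : power_expansion g -> power_expansion h ->
  power_expansion (fun t => g t * h t).
Proof.
move=> [a [M [M0 aM gM]]] [b [M' [M'0 bM hM]]].
pose c n := \sum_(i < n.+1) a i * b (n - i)%N.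
pose A N := \poly_(i < N) a i; pose B N := \poly_(i < N) b i.
have rhon n : 0 <= rho ^+ n by rewrite exprn_ge0// ltW.
have size2 N : (size (A N * B N)%R <= N + N)%N.
  rewrite (leq_trans (size_polyMleq _ _))// (leq_trans (leq_pred _))//.
  by rewrite leq_add// size_poly.
have maj N : \sum_(n < N + N) cabs (A N * B N)`_n * rho ^+ n <= M * M'.
  pose A' := \poly_(i < N) cabs (a i); pose B' := \poly_(i < N) cabs (b i).
  have s2 : (size (A' * B')%R <= N + N)%N.
    rewrite (leq_trans (size_polyMleq _ _))// (leq_trans (leq_pred _))//.
    by rewrite leq_add// size_poly.
  apply: (@le_trans _ _ (A' * B').[rho]).
    rewrite (horner_coef_wide _ s2); apply: ler_sum => n _.
    rewrite ler_wpM2r// !coefM (le_trans (cabs_sum _ _ _))//.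
    apply: ler_sum => i _; rewrite cabsM !coef_poly.
    by case: ifP => _; case: ifP => _; rewrite ?cabs0.
  by rewrite hornerM ler_pM// !horner_poly// ?sumr_ge0// => i _;
    rewrite mulr_ge0 ?cabs_ge0.
have MM : 0 <= M * M' by rewrite mulr_ge0.
exists c, (3 * (M * M')); split=> [|N|t N tr].
- by rewrite mulr_ge0.
- rewrite (@le_trans _ _ (M * M'))//; last by rewrite ler_peMl// ler1n.
  rewrite (le_trans _ (maj N))// big_split_ord/=.
  rewrite (eq_bigr (fun n : 'I_N => cabs (A N * B N)`_n * rho ^+ n)); last first.
    by move=> i _; rewrite coefM_trunc.
  by rewrite lerDl sumr_ge0// => i _; rewrite mulr_ge0 ?cabs_ge0.
- set q := (cabs t / rho) ^+ N.
  have q0 : 0 <= q by rewrite exprn_ge0// divr_ge0 ?cabs_ge0// ltW.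
  have AE : (A N).[t] = \sum_(n < N) a n * t ^+ n by rewrite horner_poly.
  have BE : (B N).[t] = \sum_(n < N) b n * t ^+ n by rewrite horner_poly.
  have hM' : cabs (h t) <= M'.
    by have := hM t 0%N tr; rewrite big_ord0 subr0 expr0 mulr1.
  have AM : cabs (A N).[t] <= M.
    rewrite AE (le_trans (cabs_sum _ _ _))// (le_trans _ (aM N))//.
    apply: ler_sum => i _; rewrite cabsM cabsX ler_wpM2l ?cabs_ge0//.
    by rewrite lerXn2r ?nnegrE ?cabs_ge0// ltW.
  (* In the term of index [N + i] only the power [|t|^N] is kept, giving the factor [q]; the power
     [|t|^i] is enlarged to [rho^i], which leaves the majorant series [maj]. *)
  have tail : cabs ((A N * B N).[t] - \sum_(n < N) c n * t ^+ n) <= M * M' * q.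
    rewrite (horner_coef_wide _ (size2 N)) big_split_ord/=.
    rewrite (eq_bigr (fun n : 'I_N => c n * t ^+ n)); last first.
      by move=> i _; rewrite coefM_trunc.
    rewrite [X in X - _]addrC addrK (le_trans (cabs_sum _ _ _))//.
    apply: (@le_trans _ _ (\sum_(i < N)
        cabs (A N * B N)`_(N + i) * rho ^+ (N + i) * q)).
      apply: ler_sum => i _; rewrite cabsM cabsX -mulrA.
      rewrite ler_wpM2l ?cabs_ge0// /q expr_div_n !exprD mulrCA mulrA.
      rewrite -mulrA [rho ^+ N * _]mulrC mulfK ?expf_neq0 ?gt_eqF//.
      rewrite ler_wpM2l ?exprn_ge0 ?cabs_ge0//.
      by rewrite lerXn2r ?nnegrE ?cabs_ge0// ltW.
    rewrite -mulr_suml ler_wpM2r// (le_trans _ (maj N))// big_split_ord/=.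
    by rewrite lerDr sumr_ge0// => i _; rewrite mulr_ge0 ?cabs_ge0.
  have -> : g t * h t - \sum_(n < N) c n * t ^+ n =
      (g t - (A N).[t]) * h t + (A N).[t] * (h t - (B N).[t]) +
      ((A N * B N).[t] - \sum_(n < N) c n * t ^+ n).
    by rewrite hornerM; ring.
  have -> : 3 * (M * M') * q = M * q * M' + M * (M' * q) + M * M' * q by ring.
  rewrite (le_trans (ler_cabsD _ _))// lerD// (le_trans (ler_cabsD _ _))//.
  by rewrite !cabsM lerD// ler_pM ?cabs_ge0// ?AE ?BE ?gM ?hM.
Qed.

(** Identity theorem in quantitative form. At a small point the first nonzero coefficient would
    dominate the remainder, so all coefficients vanish; the remainder bound then forces [g t = 0],
    since [(|t|/rho)^N] tends to 0. *)
Lemma power_expansion_zero g (delta : R) : 0 < delta -> power_expansion g ->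
  (forall t, cabs t < delta -> g t = 0) ->
  forall t, cabs t < rho -> g t = 0.
Proof.
move=> d0 [a [M [M0 _ gM]]] g0.
have az k : a k = 0.
  elim/ltn_ind: k => k IH; apply/eqP; rewrite -cabs_eq0.
  apply/negPn/negP => ak; have {ak} ak : 0 < cabs (a k).
    by rewrite lt_def ak cabs_ge0.
  have B0 : 0 <= M / rho ^+ k.+1 by rewrite divr_ge0// exprn_ge0// ltW.
  set B := M / _ in B0.
  (* At the point [s] the remainder of order [k + 1] yields [|a_k| <= s * B]; the last entry of the
     minimum makes [s * B] smaller than [|a_k|]. *)
  set s := Num.min (Num.min (delta / 2) rho) (cabs (a k) / (2 * (B + 1))).
  have B1 : 0 < 2 * (B + 1) by rewrite mulr_gt0 ?ltr_wpDl.
  have s0 : 0 < s by rewrite !lt_min rho0 !divr_gt0.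
  have sd : s < delta.
    by rewrite (@le_lt_trans _ _ (delta / 2))// ?ge_min ?lexx// ltr_pdivrMr// ltr_pMr// ltr1n.
  have sr : s <= rho by rewrite !ge_min lexx orbT.
  have sa : s * (2 * (B + 1)) <= cabs (a k).
    by rewrite -ler_pdivlMr// ge_min lexx orbT.
  have cs : cabs s%:C%C = s by rewrite cabs_real gtr0_norm.
  have := gM s%:C%C k.+1; rewrite cs => /(_ sr).
  rewrite g0 ?cs// sub0r cabsN big_ord_recr/= big1 ?add0r; last first.
    by move=> i _; rewrite IH// mul0r.
  rewrite cabsM cabsX cs expr_div_n mulrCA -/B exprS mulrAC ler_pM2r ?exprn_gt0//.
  move=> h; suff : s * B < cabs (a k) by rewrite ltNge h.
  by rewrite (lt_le_trans _ sa)// ltr_pM2l//; lra.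
move=> t tr; apply/eqP; rewrite -cabs_eq0; apply/negPn/negP => gt.
have {}gt : 0 < cabs (g t) by rewrite lt_def gt cabs_ge0.
have q1 : `|cabs t / rho| < 1.
  by rewrite ger0_norm ?divr_ge0 ?cabs_ge0 ?ltW// ltr_pdivrMr// mul1r.
have : (fun n => M * (cabs t / rho) ^+ n) @ \oo --> (M * 0 : R).
  by apply: cvgM; [exact: cvg_cst | exact: cvg_expr].
rewrite mulr0 => /cvgr_lt/(_ _ gt)[N _ /(_ N (leqnn N))] /=.
rewrite ltNge => /negP; apply.
have := gM t N (ltW tr); rewrite big1 ?subr0// => i _.
by rewrite az mul0r.
Qed.

Lemma power_expansion_eval (P : {poly {poly R[i]}}) (c : R[i]) g :
  power_expansion g -> power_expansion (fun t => eval_zw P (c + t) (g t)).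
Proof.
move=> gP; have qP (q : {poly R[i]}) : power_expansion (fun t => q.[c + t]).
  elim/poly_ind: q => [|q k IH].
    under eq_fun do rewrite horner0; exact: power_expansion_cst.
  under eq_fun do rewrite hornerMXaddC.
  apply: power_expansionD; last exact: power_expansion_cst.
  apply: power_expansionM => //; apply: power_expansionD.
    exact: power_expansion_cst.
  exact: power_expansion_id.
elim/poly_ind: P => [|P q IH].
  under eq_fun do rewrite eval_zw0; exact: power_expansion_cst.
under eq_fun do rewrite eval_zwMXaddC.
by apply: power_expansionD => //; exact: power_expansionM.
Qed.

End PowerExpansion.

(** * Measurability *)

Section Measurability.
Context d (T : measurableType d) (R : realType).
Implicit Types (f g : T -> R) (u v : T -> R[i]).

Lemma measurable_funV f : measurable_fun setT f -> (forall x, 0 <= f x) ->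
  measurable_fun setT (fun x => (f x)^-1).
Proof.
move=> mf f0; rewrite (_ : (fun x => _) = (@powR R ^~ (-1)) \o f).
  exact: measurableT_comp (measurable_powR _) mf.
by apply/funext => x /=; rewrite powR_inv1.
Qed.

Lemma measurable_fun_sqrt f : measurable_fun setT f -> (forall x, 0 <= f x) ->
  measurable_fun setT (fun x => Num.sqrt (f x)).
Proof.
move=> mf f0; rewrite (_ : (fun x => _) = (@powR R ^~ 2^-1) \o f).
  exact: measurableT_comp (measurable_powR _) mf.
by apply/funext => x /=; rewrite powR12_sqrt.
Qed.

Definition cmeasurable u :=
  measurable_fun setT (fun x => complex.Re (u x)) /\
  measurable_fun setT (fun x => complex.Im (u x)).

Lemma cmeasurable_cst (c : R[i]) : cmeasurable (fun=> c).
Proof. by split; exact: measurable_cst. Qed.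

Lemma cmeasurableD u v : cmeasurable u -> cmeasurable v ->
  cmeasurable (fun x => u x + v x).
Proof.
move=> [u1 u2] [v1 v2]; split.
  rewrite (_ : (fun x => _) = (fun x => complex.Re (u x) + complex.Re (v x))).
    exact: measurable_funD.
  by apply/funext => x; case: (u x) => ? ?; case: (v x).
rewrite (_ : (fun x => _) = (fun x => complex.Im (u x) + complex.Im (v x))).
  exact: measurable_funD.
by apply/funext => x; case: (u x) => ? ?; case: (v x).
Qed.

Lemma cmeasurableM u v : cmeasurable u -> cmeasurable v ->
  cmeasurable (fun x => u x * v x).
Proof.
move=> [u1 u2] [v1 v2]; split.
  rewrite (_ : (fun x => _) = (fun x => complex.Re (u x) * complex.Re (v x) -
      complex.Im (u x) * complex.Im (v x))).
    by apply: measurable_funB; exact: measurable_funM.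
  by apply/funext => x; case: (u x) => ? ?; case: (v x).
rewrite (_ : (fun x => _) = (fun x => complex.Re (u x) * complex.Im (v x) +
    complex.Im (u x) * complex.Re (v x))).
  by apply: measurable_funD; exact: measurable_funM.
by apply/funext => x; case: (u x) => ? ?; case: (v x).
Qed.

Lemma cmeasurable_exp u n : cmeasurable u -> cmeasurable (fun x => u x ^+ n).
Proof.
move=> mu; elim: n => [|n IH]; first exact: cmeasurable_cst.
under eq_fun do rewrite exprS; exact: cmeasurableM.
Qed.

Lemma Re_inv (z : R[i]) : complex.Re z^-1 =
  complex.Re z / (complex.Re z ^+ 2 + complex.Im z ^+ 2).
Proof. by case: z. Qed.

Lemma Im_inv (z : R[i]) : complex.Im z^-1 =
  - (complex.Im z / (complex.Re z ^+ 2 + complex.Im z ^+ 2)).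
Proof. by case: z. Qed.

Lemma cmeasurableV u : cmeasurable u -> cmeasurable (fun x => (u x)^-1).
Proof.
move=> [u1 u2].
have mq : measurable_fun setT
    (fun x => (complex.Re (u x) ^+ 2 + complex.Im (u x) ^+ 2)^-1).
  apply: measurable_funV => [|x]; last by rewrite addr_ge0 ?sqr_ge0.
  by apply: measurable_funD; exact: measurable_funX.
split; first by under eq_fun do rewrite Re_inv; exact: measurable_funM.
by under eq_fun do rewrite Im_inv; apply: measurable_funN; exact: measurable_funM.
Qed.

Lemma measurable_cabs u : cmeasurable u -> measurable_fun setT (fun x => cabs (u x)).
Proof.
move=> [u1 u2]; rewrite (_ : (fun x => _) =
    (fun x => Num.sqrt (complex.Re (u x) ^+ 2 + complex.Im (u x) ^+ 2))).
  apply: measurable_fun_sqrt => [|x]; last by rewrite addr_ge0 ?sqr_ge0.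
  by apply: measurable_funD; exact: measurable_funX.
by apply/funext => x; case: (u x).
Qed.

Lemma cmeasurable_eval_zw (P : {poly {poly R[i]}}) u v :
  cmeasurable u -> cmeasurable v -> cmeasurable (fun x => eval_zw P (u x) (v x)).
Proof.
move=> mu mv; have mq (q : {poly R[i]}) : cmeasurable (fun x => q.[u x]).
  elim/poly_ind: q => [|q k IH].
    under eq_fun do rewrite horner0; exact: cmeasurable_cst.
  under eq_fun do rewrite hornerMXaddC.
  by apply: cmeasurableD; [exact: cmeasurableM | exact: cmeasurable_cst].
elim/poly_ind: P => [|P q IH].
  under eq_fun do rewrite eval_zw0; exact: cmeasurable_cst.
under eq_fun do rewrite eval_zwMXaddC.
by apply: cmeasurableD => //; exact: cmeasurableM.
Qed.

End Measurability.

Section ParametricIntegral.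
Context d1 d2 (T1 : measurableType d1) (T2 : measurableType d2) (R : realType).
Variable m2 : {finite_measure set T2 -> \bar R}.

(** Integrability of the slices is not assumed. Tonelli handles the positive and negative parts
    separately, and [fine] supplies the default value where their difference is infinite. *)
Lemma measurable_Rintegral_param (f : T1 * T2 -> R) : measurable_fun setT f ->
  measurable_fun setT (fun x => Rintegral m2 setT (fun y => f (x, y))).
Proof.
move=> mf; have mE : measurable_fun [set: T1 * T2] (EFin \o f) by exact/measurable_EFinP.
rewrite (_ : (fun x => _) = fine \o
  (fubini_F m2 ((EFin \o f)^\+)%E \- fubini_F m2 ((EFin \o f)^\-)%E)%E).
  apply: measurableT_comp => //; apply: emeasurable_funB.
    apply: measurable_fun_fubini_tonelli_F; first exact: measurable_funepos.
    by move=> x; exact: funepos_ge0.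
  apply: measurable_fun_fubini_tonelli_F; first exact: measurable_funeneg.
  by move=> x; exact: funeneg_ge0.
apply/funext => x; rewrite /Rintegral [in LHS]integralE /= /fubini_F.
by congr (fine (_ - _)%E); apply: eq_integral => y _; rewrite ?funeposE ?funenegE.
Qed.

End ParametricIntegral.

Section Plane.
Variable R : realType.

Lemma measurable_x : measurable_fun setT (fun z : plane R => z.1 : R).
Proof. exact: measurable_fst. Qed.

Lemma measurable_y : measurable_fun setT (fun z : plane R => z.2 : R).
Proof. exact: measurable_snd. Qed.

Lemma cmeasurable_cplx : cmeasurable (@cplx R).
Proof. by split; [exact: measurable_x | exact: measurable_y]. Qed.

Lemma cmeasurable_sub_cplx :
  cmeasurable (fun p : plane R * plane R => cplx p.1 - cplx p.2).
Proof.
split; apply: measurable_funB.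
- exact: (measurableT_comp measurable_x measurable_fst).
- exact: (measurableT_comp measurable_x measurable_snd).
- exact: (measurableT_comp measurable_y measurable_fst).
- exact: (measurableT_comp measurable_y measurable_snd).
Qed.

Lemma cmeasurable_cauchy_transform (mu : {finite_measure set (plane R) -> \bar R}) :
  cmeasurable (cauchy_transform mu).
Proof.
have [m1 m2] := cmeasurableV cmeasurable_sub_cplx.
split.
  exact: (@measurable_Rintegral_param _ _ _ _ _ mu _ m1).
exact: (@measurable_Rintegral_param _ _ _ _ _ mu _ m2).
Qed.

Lemma measurable_disc (a : plane R) r : measurable (disc a r).
Proof.
have m : measurable_fun setT (fun z : plane R => cabs (cplx z - cplx a)).
  apply: measurable_cabs; apply: cmeasurableD; first exact: cmeasurable_cplx.
  exact: cmeasurable_cst.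
rewrite (_ : disc a r = setT `&` (fun z => cabs (cplx z - cplx a)) @^-1` `]-oo, r[).
  exact: m.
by rewrite setTI; apply/seteqP; split=> z; rewrite /disc /= in_itv.
Qed.

End Plane.

(** * Integrability of the Newtonian kernel *)

Section SupDistance.
Variable R : realType.
Implicit Types (a z w : plane R) (s : R).

(** The sup norm is preferred to the modulus because its closed balls are products of intervals,
    whose area and iterated integrals are explicit. *)
Definition sup_dist z w : R :=
  Num.max `|(z.1 : R) - (w.1 : R)| `|(z.2 : R) - (w.2 : R)|.

Definition box a s : set (plane R) :=
  `[(a.1 : R) - s, (a.1 : R) + s] `*` `[(a.2 : R) - s, (a.2 : R) + s].

Lemma boxP a s z : box a s z <-> sup_dist z a <= s.
Proof.
rewrite /box /sup_dist /= !in_itv /= ge_max !ler_distl.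
by split=> [[-> ->]|/andP[]].
Qed.

Lemma measurable_box a s : measurable (box a s).
Proof. by apply: measurableX; exact: measurable_itv. Qed.

(* The same measure as [planar_lebesgue], with a head constant that can carry the
   sigma-finite structure needed by Fubini's theorem. *)
Definition lebesgue2 : set (plane R) -> \bar R :=
  (@lebesgue_measure R \x @lebesgue_measure R)%E.

HB.instance Definition _ := Measure.on lebesgue2.

Lemma lebesgue_box a s : 0 <= s -> lebesgue2 (box a s) = (4 * s ^+ 2)%:E.
Proof.
move=> s0; pose xa : R := a.1; pose ya : R := a.2.
have E (c : R) : lebesgue_measure (`[c - s, c + s] : set R) = (2 * s)%:E.
  rewrite lebesgue_measure_itv/= lte_fin.
  have [->|sn0] := eqVneq s 0; first by rewrite subr0 addr0 ltxx mulr0.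
  rewrite ifT; last by rewrite ltrD2l gtrN// lt_def sn0.
  by rewrite -EFinB; congr EFin; ring.
transitivity (lebesgue_measure (`[((xa) - s)%R, ((xa) + s)%R]%classic : set R) *
    lebesgue_measure (`[((ya) - s)%R, ((ya) + s)%R]%classic : set R))%E.
  by apply: product_measure1E; exact: measurable_itv.
by rewrite (E xa) (E ya) -EFinM; congr EFin; ring.
Qed.

Let lebesgue2_sigma_finite : sigma_finite setT lebesgue2.
Proof.
exists (fun n => box (0, 0) n%:R) => [|n]; last first.
  by split; [exact: measurable_box | rewrite lebesgue_box// ltry].
apply/seteqP; split=> // z _; exists (Num.truncn (sup_dist z (0, 0))).+1 => //.
by apply/boxP/ltW/Num.Theory.truncnS_gt.
Qed.

HB.instance Definition _ :=
  Measure_isSigmaFinite.Build _ _ _ lebesgue2 lebesgue2_sigma_finite.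

Lemma sup_dist_ge0 z w : 0 <= sup_dist z w.
Proof. by rewrite le_max normr_ge0. Qed.

Lemma sup_distC z w : sup_dist z w = sup_dist w z.
Proof. by rewrite /sup_dist distrC [X in Num.max _ X]distrC. Qed.

Lemma sup_dist_triangle z w (v : plane R) : sup_dist z v <= sup_dist z w + sup_dist w v.
Proof.
have t (x y k : R) : `|x - k| <= `|x - y| + `|y - k|.
  by rewrite -[x - k](subrKA y) ler_normD.
rewrite {1}/sup_dist ge_max; apply/andP; split.
  by apply: le_trans (t _ (w.1 : R) _) _; rewrite lerD// le_max lexx.
by apply: le_trans (t _ (w.2 : R) _) _; rewrite lerD// le_max lexx orbT.
Qed.

Lemma measurable_sup_dist :
  measurable_fun setT (fun p : plane R * plane R => sup_dist p.1 p.2).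
Proof.
have [m1 m2] := @cmeasurable_sub_cplx R.
by apply: measurable_maxr; exact: measurableT_comp.
Qed.

(** Dyadic decomposition: if the distance lies between [2^-(k+1)] and [2^-k], the term of index [k]
    alone suffices. The summand 1 covers distances at least 1, and on the diagonal the inverse is 0
    by convention. *)
Lemma inv_sup_dist_le_series z w : (((sup_dist z w)^-1)%:E <=
  1 + \sum_(k <oo) (2 ^+ k.+1 * \1_(box w (2^-1 ^+ k)) z)%:E)%E.
Proof.
have S0 : (0 <= \sum_(k <oo) (2 ^+ k.+1 * \1_(box w (2^-1 ^+ k)) z)%:E :> \bar R)%E.
  by apply: nneseries_ge0 => k _ _; rewrite lee_fin mulr_ge0// exprn_ge0.
have [m1|m1] := leP 1 (sup_dist z w).
  rewrite (@le_trans _ _ 1%E)//; last by rewrite leeDl.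
  by rewrite lee_fin invf_le1// (lt_le_trans ltr01).
have [m0|m0] := eqVneq (sup_dist z w) 0.
  by rewrite m0 invr0 adde_ge0.
have {m0} mp : 0 < sup_dist z w by rewrite lt_def m0 sup_dist_ge0.
have : exists k, 2^-1 ^+ k < sup_dist z w.
  have : (fun n : nat => (2^-1 : R) ^+ n) @ \oo --> (0 : R).
    by apply: cvg_expr; rewrite ger0_norm// invf_lt1// ltr1n.
  by move=> /cvgr_lt/(_ _ mp)[N _ /(_ N (leqnn N))] /=; exists N.
move=> /ex_minnP[[|k] kP kmin].
  by move: kP; rewrite expr0 ltNge (ltW m1).
have zk : sup_dist z w <= 2^-1 ^+ k.
  by rewrite leNgt; apply/negP => /kmin; rewrite ltnn.
apply: le_trans (leeDr _ _); last by [].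
have := @nneseries_lim_ge R (fun k => (2 ^+ k.+1 * \1_(box w (2^-1 ^+ k)) z)%:E)
   xpredT 0 k.+1.
have g0 n : (0 <= n)%N -> xpredT n ->
    (0 <= (2 ^+ n.+1 * \1_(box w (2^-1 ^+ n)) z)%:E :> \bar R)%E.
  by move=> _ _; rewrite lee_fin mulr_ge0// exprn_ge0.
move=> /(_ g0); apply: le_trans.
rewrite big_nat_recr//= (le_trans _ (leeDr _ _))//; last first.
  by apply: sume_ge0 => n _; exact: g0.
rewrite lee_fin indicE mem_set ?mulr1; last by apply/boxP.
by rewrite -[leRHS]invrK -exprVn lef_pV2 ?posrE ?exprn_gt0// ltW.
Qed.

(** The bound does not depend on [w], as is needed to integrate it against a finite measure
    later. *)
Lemma integral_inv_sup_dist a w s : 0 <= s ->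
  (\int[lebesgue2]_(z in box a s) ((sup_dist z w)^-1)%:E <= (4 * s ^+ 2 + 16)%:E)%E.
Proof.
move=> s0; have mB := measurable_box a s.
pose f k z := (2 ^+ k.+1 * \1_(box w (2^-1 ^+ k)) z)%:E : \bar R.
have f0 k z : (0 <= f k z)%E by rewrite lee_fin mulr_ge0// exprn_ge0.
have mf k : measurable_fun (box a s) (f k).
  apply/measurable_EFinP; apply: measurable_funM => //.
  by apply: measurable_indic; exact: measurable_box.
have mS : measurable_fun (box a s) (fun z => \sum_(k <oo) f k z)%E.
  by apply: ge0_emeasurable_sum => // k z _ _; exact: f0.
apply: (@le_trans _ _ (\int[lebesgue2]_(z in box a s) (1 + \sum_(k <oo) f k z))%E).
  apply: ge0_le_integral => //.
  - by move=> z _; rewrite lee_fin invr_ge0 sup_dist_ge0.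
  - apply/measurable_EFinP; apply: measurable_funTS.
    apply: measurable_funV => [|z]; last exact: sup_dist_ge0.
    exact: (measurable_fun_pair1 w measurable_sup_dist).
  - exact: emeasurable_funD.
  - by move=> z _; exact: inv_sup_dist_le_series.
rewrite ge0_integralD//; last by move=> z _; apply: nneseries_ge0 => k _ _; exact: f0.
rewrite EFinD leeD//.
  by rewrite integral_cst// mul1e [X in (X <= _)%E](lebesgue_box a s0).
rewrite integral_nneseries//.
(* The box of half-side [2^-k] has area [4 * 4^-k]; with the weight [2^(k+1)] this gives
   [16 / 2^(k+1)], a series of sum 16. *)
apply: le_trans (epsilon_trick0 xpredT (_ : 0 <= 16)) => //.
apply: lee_nneseries => [k _ _|k _]; first by apply: integral_ge0 => z _; exact: f0.
rewrite /f; under eq_integral do rewrite EFinM.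
rewrite ge0_integralZl//; last first.
  by apply/measurable_EFinP; apply: measurable_indic; exact: measurable_box.
have mE := measurable_box w (2^-1 ^+ k).
rewrite integral_indic//.
apply: (@le_trans _ _ ((2 ^+ k.+1)%:E * lebesgue2 (box w (2^-1 ^+ k)))%E).
  rewrite lee_wpmul2l ?lee_fin ?exprn_ge0//.
  by apply: le_measure; rewrite ?inE//; exact: measurableI.
rewrite lebesgue_box ?exprn_ge0// -EFinM lee_fin natrX exprVn.
have h : (2 : R) ^+ k != 0 by rewrite expf_neq0.
by rewrite !exprS expr0 le_eqVlt; apply/orP; left; apply/eqP; field.
Qed.

End SupDistance.
Arguments lebesgue2 {R}.

(** * The cutoff kernel *)

Section Calculus.
Variable R : realType.

Lemma integral_derivative_zero (F dF : R -> R) (c s : R) : 0 < s ->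
  (forall x : R, is_derive x 1 F (dF x)) -> continuous dF ->
  F (c - s) = 0 -> F (c + s) = 0 ->
  (\int[lebesgue_measure]_(x in `[(c - s)%R, (c + s)%R]) (dF x)%:E = 0)%E.
Proof.
move=> s0 FdF cdF Fl Fr.
have cF : continuous F.
  by move=> x; apply/differentiable_continuous/derivable1_diffP; case: (FdF x).
rewrite (@continuous_FTC2 _ dF F).
- by rewrite Fl Fr subee.
- by rewrite ltrD2l gtrN.
- by apply: continuous_subspaceT.
- split; first by move=> x _; case: (FdF x).
  + by apply: cvg_at_right_filter; exact: cF.
  + by apply: cvg_at_left_filter; exact: cF.
- by move=> x _; rewrite derive1E; case: (FdF x).
Qed.

Definition hat (c s x : R) : R := 1 - ((x - c) / s) ^+ 2.
Definition dhat (c s x : R) : R := - (2 * (x - c) / s ^+ 2).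

Lemma is_derive_hat c s (x : R) : s != 0 ->
  is_derive x 1 (hat c s) (dhat c s x).
Proof.
move=> s0; rewrite /hat; apply: is_derive_eq.
by rewrite /dhat /GRing.scale /=; field.
Qed.

(** Slice along one axis of the bump times a component of the regularised gradient: [p] stands for
    [e] plus the squared difference in the other coordinate, and the other factor of the bump is a
    constant on the slice. *)
Definition flux (c s xi p x : R) : R := hat c s x * ((x - xi) / ((x - xi) ^+ 2 + p)).
Definition dflux (c s xi p x : R) : R :=
  dhat c s x * ((x - xi) / ((x - xi) ^+ 2 + p)) +
  hat c s x * (((x - xi) ^+ 2 + p)^-1 - 2 * ((x - xi) / ((x - xi) ^+ 2 + p)) ^+ 2).

Lemma is_derive_flux c s xi p (x : R) : s != 0 -> 0 < p ->
  is_derive x 1 (flux c s xi p) (dflux c s xi p x).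
Proof.
move=> s0 p0; have D := is_derive_hat c x s0.
have q0 : (x - xi) ^+ 2 + p != 0 by rewrite gt_eqF// ltr_wpDl// sqr_ge0.
rewrite /flux; apply: is_derive_eq.
rewrite /dflux /GRing.scale /=; field; exact: q0.
Qed.

Lemma continuous_dflux k c s xi p : s != 0 -> 0 < p ->
  continuous (fun x => k * dflux c s xi p x).
Proof.
move=> s0 p0 x; have D := is_derive_hat c x s0.
have q0 : (x - xi) ^+ 2 + p != 0 by rewrite gt_eqF// ltr_wpDl// sqr_ge0.
apply/differentiable_continuous/derivable1_diffP.
suff [d []] : exists d : R,
    is_derive x 1 (fun x => k * dflux c s xi p x) d by [].
by eexists; rewrite /dflux /dhat; typeclasses eauto.
Qed.

Lemma integral_dflux k c s xi p : 0 < s -> 0 < p ->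
  (\int[lebesgue_measure]_(x in `[(c - s)%R, (c + s)%R])
     (k * dflux c s xi p x)%:E = 0)%E.
Proof.
move=> s0 p0; have sn0 : s != 0 by rewrite gt_eqF.
apply: (@integral_derivative_zero (fun x => k * flux c s xi p x)
  (fun x => k * dflux c s xi p x) c s s0).
- move=> x; have D := is_derive_flux c xi x sn0 p0.
  by apply: is_derive_eq; rewrite /GRing.scale /=; ring.
- exact: continuous_dflux.
- rewrite /flux /hat [X in X / s](_ : _ = - s); last by ring.
  by rewrite mulNr mulfV// sqrrN expr1n subrr mul0r mulr0.
- rewrite /flux /hat [X in X / s](_ : _ = s); last by ring.
  by rewrite mulfV// expr1n subrr mul0r mulr0.
Qed.

Lemma hat_bounds c s x : 0 < s -> x \in `[c - s, c + s] -> 0 <= hat c s x <= 1.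
Proof.
move=> s0; rewrite in_itv/= -ler_distl => xc.
rewrite /hat subr_ge0 lerBlDl lerDr sqr_ge0 andbT.
by rewrite -real_normK ?num_real// expr_le1// normrM normfV (gtr0_norm s0) ler_pdivrMr// mul1r.
Qed.

Lemma dhat_bound c s x : 0 < s -> x \in `[c - s, c + s] -> `|dhat c s x| <= 2 / s.
Proof.
move=> s0; rewrite in_itv/= -ler_distl => xc.
rewrite /dhat normrN !normrM normfV (gtr0_norm (exprn_gt0 2 s0)) ger0_norm//.
rewrite ler_pdivrMr ?exprn_gt0// [leRHS](_ : _ = 2 * s) ?ler_wpM2l//.
by field; rewrite gt_eqF.
Qed.

End Calculus.

Section BoxIntegrals.
Variables (R : realType) (a : plane R) (s : R).
Hypothesis s0 : 0 < s.
Implicit Types (f g : plane R -> R) (z w : plane R).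

(** A class of functions closed under sums and products and integrable over the box, so that
    integrability of the long expressions below follows from their shape. *)
Definition tame f := measurable_fun setT f /\
  exists M : R, forall z, box a s z -> `|f z| <= M.

Lemma tame_cst (k : R) : tame (fun=> k).
Proof. by split; [exact: measurable_cst | exists `|k|]. Qed.

Lemma tameD f g : tame f -> tame g -> tame (fun z => f z + g z).
Proof.
move=> [mf [M fM]] [mg [N gN]]; split; first exact: measurable_funD.
by exists (M + N) => z Bz; rewrite (le_trans (ler_normD _ _))// lerD ?fM ?gN.
Qed.

Lemma tameM f g : tame f -> tame g -> tame (fun z => f z * g z).
Proof.
move=> [mf [M fM]] [mg [N gN]]; split; first exact: measurable_funM.
by exists (M * N) => z Bz; rewrite normrM ler_pM ?fM ?gN.
Qed.

Lemma tameN f : tame f -> tame (fun z => - f z).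
Proof.
move=> [mf [M fM]]; split; first exact: measurable_funN.
by exists M => z Bz; rewrite normrN fM.
Qed.

Lemma tame_integrable f : tame f -> lebesgue2.-integrable (box a s) (EFin \o f).
Proof.
move=> [mf [M fM]]; apply: measurable_bounded_integrable.
- exact: measurable_box.
- by rewrite [X in (X < _)%E]lebesgue_box ?ltry// ltW.
- exact: measurable_funTS.
- exists M; split; first exact: num_real.
  by move=> N MN z Bz /=; exact: le_trans (fM z Bz) (ltW MN).
Qed.

Local Notation I1 := `[(a.1 : R) - s, (a.1 : R) + s]%classic.
Local Notation I2 := `[(a.2 : R) - s, (a.2 : R) + s]%classic.

Lemma tame_patch_integrable f : tame f ->
  lebesgue2.-integrable setT ((EFin \o f) \_ (box a s)).
Proof.
by move=> ft; apply/(integrable_mkcond _ (measurable_box a s)); exact: tame_integrable.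
Qed.

(** Fubini is applied to [f] extended by zero to the plane; the slices that miss the box vanish
    identically, the others by hypothesis. *)
Lemma tame_integral0_x f : tame f ->
  (forall y : R, (\int[lebesgue_measure]_(x in I1) (f (x, y))%:E = 0)%E) ->
  (\int[lebesgue2]_(z in box a s) (f z)%:E = 0)%E.
Proof.
move=> ft f0; have fi := tame_patch_integrable ft.
rewrite integral_mkcond -[LHS](integral21_prod_meas1 fi).
apply: integral0_eq => y _; rewrite /fubini_G.
have [yI|yI] := pselect (I2 y).
  rewrite -(f0 y) [RHS]integral_mkcond; apply: eq_integral => x _.
  rewrite !patchE; congr (if _ then _ else _).
  by apply/idP/idP; rewrite !inE => h; [case: h | split].
apply: integral0_eq => x _; rewrite patchE ifF//.
by apply/negbTE; rewrite notin_setE => -[].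
Qed.

Lemma tame_integral0_y f : tame f ->
  (forall x : R, (\int[lebesgue_measure]_(y in I2) (f (x, y))%:E = 0)%E) ->
  (\int[lebesgue2]_(z in box a s) (f z)%:E = 0)%E.
Proof.
move=> ft f0; have fi := tame_patch_integrable ft.
rewrite integral_mkcond -[LHS](integral12_prod_meas1 fi).
apply: integral0_eq => x _; rewrite /fubini_F.
have [xI|xI] := pselect (I1 x).
  rewrite -(f0 x) [RHS]integral_mkcond; apply: eq_integral => y _.
  rewrite !patchE; congr (if _ then _ else _).
  by apply/idP/idP; rewrite !inE => h; [case: h | split].
apply: integral0_eq => y _; rewrite patchE ifF//.
by apply/negbTE; rewrite notin_setE => -[].
Qed.

Definition sqr_dist z w : R :=
  ((z.1 : R) - (w.1 : R)) ^+ 2 + ((z.2 : R) - (w.2 : R)) ^+ 2.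

Definition hat1 z := hat (a.1 : R) s z.1.
Definition hat2 z := hat (a.2 : R) s z.2.
Definition dhat1 z := dhat (a.1 : R) s z.1.
Definition dhat2 z := dhat (a.2 : R) s z.2.

(* Regularised gradient of log |z - w|. *)
Definition grad1 e w z := ((z.1 : R) - (w.1 : R)) / (sqr_dist z w + e).
Definition grad2 e w z := ((z.2 : R) - (w.2 : R)) / (sqr_dist z w + e).

(** For [chi = hat1 * hat2] this is minus the scalar product of the gradient of [chi] with the
    regularised gradient. It makes sense at [e = 0] too, where division by zero gives the value 0 at
    [z = w]. *)
Definition cutoff_kernel e w z :=
  - (dhat1 z * hat2 z * grad1 e w z + hat1 z * dhat2 z * grad2 e w z).

Lemma sqr_dist_ge0 z w : 0 <= sqr_dist z w.
Proof. by rewrite addr_ge0 ?sqr_ge0. Qed.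

Lemma measurable_sqr_dist : measurable_fun setT
  (fun p : plane R * plane R => sqr_dist p.1 p.2).
Proof.
have [m1 m2] := @cmeasurable_sub_cplx R.
by apply: measurable_funD; exact: measurable_funX.
Qed.

Lemma measurable_hats : [/\ measurable_fun setT hat1, measurable_fun setT hat2,
  measurable_fun setT dhat1 & measurable_fun setT dhat2].
Proof.
have mx := @measurable_x R; have my := @measurable_y R.
have mxc (k : R) : measurable_fun setT (fun z : plane R => (z.1 : R) - k).
  by apply: measurable_funB => //; exact: measurable_cst.
have myc (k : R) : measurable_fun setT (fun z : plane R => (z.2 : R) - k).
  by apply: measurable_funB => //; exact: measurable_cst.
split.
- apply: measurable_funB; first exact: measurable_cst.
  by apply: measurable_funX; apply: measurable_funM => //; exact: measurable_cst.
- apply: measurable_funB; first exact: measurable_cst.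
  by apply: measurable_funX; apply: measurable_funM => //; exact: measurable_cst.
- apply: measurable_funN; apply: measurable_funM; last exact: measurable_cst.
  by apply: measurable_funM => //; exact: measurable_cst.
- apply: measurable_funN; apply: measurable_funM; last exact: measurable_cst.
  by apply: measurable_funM => //; exact: measurable_cst.
Qed.

Lemma tame_hats : [/\ tame hat1, tame hat2, tame dhat1 & tame dhat2].
Proof.
have [m1 m2 m3 m4] := measurable_hats.
split; split=> //; [exists 1|exists 1|exists (2 / s)|exists (2 / s)] => z [z1 z2].
- by have /andP[b0 b1] := hat_bounds s0 z1; rewrite ger0_norm.
- by have /andP[b0 b1] := hat_bounds s0 z2; rewrite ger0_norm.
- exact: dhat_bound s0 z1.
- exact: dhat_bound s0 z2.
Qed.

Lemma measurable_inv_reg e : 0 <= e -> measurable_fun setT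
  (fun p : plane R * plane R => (sqr_dist p.1 p.2 + e)^-1).
Proof.
move=> e0; apply: measurable_funV => [|p]; last first.
  by rewrite addr_ge0// sqr_dist_ge0.
by apply: measurable_funD; [exact: measurable_sqr_dist | exact: measurable_cst].
Qed.

Lemma measurable_grads e : 0 <= e ->
  measurable_fun setT (fun p : plane R * plane R => grad1 e p.2 p.1) /\
  measurable_fun setT (fun p : plane R * plane R => grad2 e p.2 p.1).
Proof.
move=> e0; have [m1 m2] := @cmeasurable_sub_cplx R.
by split; apply: measurable_funM => //; exact: measurable_inv_reg.
Qed.

Lemma measurable_cutoff_kernel e : 0 <= e ->
  measurable_fun setT (fun p : plane R * plane R => cutoff_kernel e p.2 p.1).
Proof.
move=> e0; have [m1 m2] := measurable_grads e0.
have [b1 b2 b3 b4] := measurable_hats.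
have M f : measurable_fun setT f ->
  measurable_fun setT (fun p : plane R * plane R => f p.1).
  by move=> mf; exact: (measurableT_comp mf measurable_fst).
apply: measurable_funN; apply: measurable_funD; apply: measurable_funM => //;
by apply: measurable_funM; exact: M.
Qed.

Lemma tame_reg e w : 0 < e ->
  [/\ tame (fun z => (sqr_dist z w + e)^-1), tame (grad1 e w) & tame (grad2 e w)].
Proof.
move=> e0; have [m1 m2] := measurable_grads (ltW e0).
have m3 := measurable_inv_reg (ltW e0).
have q0 z : 0 < sqr_dist z w + e by rewrite ltr_wpDl// sqr_dist_ge0.
(* A crude bound that degenerates with [e]; it serves only integrability at a fixed positive [e]. *)
have B (t : R) z : t ^+ 2 <= sqr_dist z w -> `|t / (sqr_dist z w + e)| <= e^-1 + 1.
  move=> tq; rewrite normrM normfV (gtr0_norm (q0 z)) ler_pdivrMr//.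
  have t1 : `|t| <= 1 + t ^+ 2.
    by rewrite -(real_normK (num_real t)); have := sqr_ge0 (`|t| - 1); nra.
  rewrite (le_trans t1)// mulrDl mul1r mulrDr mulVf ?gt_eqF//.
  have : 0 <= e^-1 * sqr_dist z w by rewrite mulr_ge0 ?invr_ge0 ?(ltW e0)// sqr_dist_ge0.
  by lra.
split; split.
- exact: (measurable_fun_pair1 w m3).
- exists e^-1 => z _; rewrite normfV (gtr0_norm (q0 z)) lef_pV2 ?posrE//.
  by rewrite lerDr sqr_dist_ge0.
- exact: (measurable_fun_pair1 w m1).
- by exists (e^-1 + 1) => z _; apply: B; rewrite lerDl sqr_ge0.
- exact: (measurable_fun_pair1 w m2).
- by exists (e^-1 + 1) => z _; apply: B; rewrite lerDr sqr_ge0.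
Qed.

(* Integration by parts against the Laplacian
   [2e/(|z-w|^2+e)^2] of the regularised logarithm. *)
Lemma integral_cutoff_kernel e w : 0 < e ->
  (\int[lebesgue2]_(z in box a s) (cutoff_kernel e w z)%:E =
   \int[lebesgue2]_(z in box a s)
     (hat1 z * hat2 z * (2 * e * ((sqr_dist z w + e)^-1) ^+ 2))%:E)%E.
Proof.
move=> e0; have [tb1 tb2 td1 td2] := tame_hats.
have [tq tg1 tg2] := tame_reg w e0.
(* [f1] and [f2] are the partial derivatives, in the first and second coordinate, of the bump times
   the corresponding component of the gradient. Their integrals vanish, and their sum is minus the
   kernel plus the bump times the Laplacian. *)
pose f1 z := hat2 z * (dhat1 z * grad1 e w z +
  hat1 z * ((sqr_dist z w + e)^-1 - 2 * (grad1 e w z * grad1 e w z))).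
pose f2 z := hat1 z * (dhat2 z * grad2 e w z +
  hat2 z * ((sqr_dist z w + e)^-1 - 2 * (grad2 e w z * grad2 e w z))).
have tf1 : tame f1.
  apply: tameM => //; apply: tameD; first exact: tameM.
  apply: tameM => //; apply: tameD => //; apply: tameN; apply: tameM; first exact: tame_cst.
  exact: tameM.
have tf2 : tame f2.
  apply: tameM => //; apply: tameD; first exact: tameM.
  apply: tameM => //; apply: tameD => //; apply: tameN; apply: tameM; first exact: tame_cst.
  exact: tameM.
have i1 : (\int[lebesgue2]_(z in box a s) (f1 z)%:E = 0)%E.
  apply: tame_integral0_x => // y.
  have p0 : 0 < (y - (w.2 : R)) ^+ 2 + e by rewrite ltr_wpDl// sqr_ge0.
  rewrite -(integral_dflux (hat (a.2 : R) s y) (a.1 : R) (w.1 : R) s0 p0).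
  apply: eq_integral => x _; congr EFin.
  rewrite /f1 /dflux /hat1 /hat2 /dhat1 /grad1 /sqr_dist /=.
  by rewrite addrA expr2.
have i2 : (\int[lebesgue2]_(z in box a s) (f2 z)%:E = 0)%E.
  apply: tame_integral0_y => // x.
  have p0 : 0 < (x - (w.1 : R)) ^+ 2 + e by rewrite ltr_wpDl// sqr_ge0.
  rewrite -(integral_dflux (hat (a.1 : R) s x) (a.2 : R) (w.2 : R) s0 p0).
  apply: eq_integral => y _; congr EFin.
  rewrite /f2 /dflux /hat1 /hat2 /dhat2 /grad2 /sqr_dist /=.
  by rewrite [_ + (y - _) ^+ 2]addrC addrA expr2.
have tk : tame (cutoff_kernel e w).
  by apply: tameN; apply: tameD; apply: tameM => //; exact: tameM.
have E z : hat1 z * hat2 z * (2 * e * ((sqr_dist z w + e)^-1) ^+ 2) =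
    cutoff_kernel e w z + (f1 z + f2 z).
  have q0 : (sqr_dist z w + e) != 0 by rewrite gt_eqF// ltr_wpDl// sqr_dist_ge0.
  rewrite /cutoff_kernel /f1 /f2 /grad1 /grad2.
  have -> : 2 * e * ((sqr_dist z w + e)^-1) ^+ 2 = 2 * (sqr_dist z w + e)^-1 -
     2 * (sqr_dist z w) * ((sqr_dist z w + e)^-1) ^+ 2 by field.
  by set v := (_ + e)^-1; rewrite /sqr_dist; ring.
have -> : (\int[lebesgue2]_(z in box a s)
     (hat1 z * hat2 z * (2 * e * ((sqr_dist z w + e)^-1) ^+ 2))%:E =
   \int[lebesgue2]_(z in box a s) ((cutoff_kernel e w z)%:E + ((f1 z)%:E + (f2 z)%:E)))%E.
  by apply: eq_integral => z _; rewrite E !EFinD.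
have mB := measurable_box a s.
have := tame_integrable tk; have := tame_integrable tf1; have := tame_integrable tf2.
move=> if2 if1 ik.
rewrite integralD//; last exact: integrableD.
by rewrite integralD// i1 i2 !adde0.
Qed.

End BoxIntegrals.

(** * Positivity, lower bound and domination of the cutoff kernel *)

Section KernelLowerBound.
Variables (R : realType) (a : plane R) (s : R).
Hypothesis s0 : 0 < s.
Implicit Types (z w : plane R).

Lemma hat_ge (c x : R) : `|x - c| <= s / 2 -> 3 / 4 <= hat c s x.
Proof.
move=> xc; rewrite /hat.
have : ((x - c) / s) ^+ 2 <= (1 / 2) ^+ 2.
  rewrite -real_normK ?num_real// lerXn2r ?nnegrE//.
  by rewrite normrM normfV (gtr0_norm s0) ler_pdivrMr// mul1r mulrC.
by lra.
Qed.

Lemma sqr_dist_le z w : sqr_dist z w <= 2 * sup_dist z w ^+ 2.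
Proof.
have t (x m : R) : `|x| <= m -> x ^+ 2 <= m ^+ 2.
  move=> xm; rewrite -real_normK ?num_real// lerXn2r// nnegrE//.
  exact: le_trans (normr_ge0 _) xm.
rewrite mulr_natl mulr2n lerD// t// le_max lexx//.
by rewrite orbT.
Qed.

Lemma sqr_sup_dist_le z w : sup_dist z w ^+ 2 <= sqr_dist z w.
Proof.
rewrite /sup_dist; case: (leP `|(z.1 : R) - (w.1 : R)|) => _;
by rewrite real_normK ?num_real// ?lerDl ?lerDr sqr_ge0.
Qed.

Let integrand e w z := hat1 a s z * hat2 a s z * (2 * e * (sqr_dist z w + e)^-1 ^+ 2).

Let integrand_ge0 e w z : 0 <= e -> box a s z -> 0 <= integrand e w z.
Proof.
move=> e0 [z1 z2]; have /andP[h1 _] := hat_bounds s0 z1.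
have /andP[h2 _] := hat_bounds s0 z2.
apply: mulr_ge0; first exact: mulr_ge0.
by apply: mulr_ge0; [exact: mulr_ge0 | exact: sqr_ge0].
Qed.

Lemma integral_cutoff_kernel_ge0 e w : 0 < e ->
  (0 <= \int[lebesgue2]_(z in box a s) (cutoff_kernel a s e w z)%:E)%E.
Proof.
move=> e0; rewrite integral_cutoff_kernel//; apply: integral_ge0 => z Bz.
by rewrite lee_fin; apply: integrand_ge0 => //; exact: ltW.
Qed.

(** On the box of half-side [r] about [w] both hats are at least 3/4 and the denominator is at most
    [(3r^2)^2], so the integrand is at least [1/(8r^2)]. The area [4r^2] turns this into 1/2,
    whatever [r] is. *)
Lemma integral_cutoff_kernel_ge r w : 0 < r <= s / 4 -> sup_dist w a <= s / 4 ->
  ((2^-1)%:E <= \int[lebesgue2]_(z in box a s) (cutoff_kernel a s (r ^+ 2) w z)%:E)%E.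
Proof.
move=> /andP[r0 rs] wa; have e0 : 0 < r ^+ 2 by rewrite exprn_gt0.
have mw := measurable_box w r; have ma := measurable_box a s.
have za z : box w r z -> sup_dist z a <= s / 2.
  move=> /boxP zw; apply: le_trans (sup_dist_triangle z w a) _.
  by lra.
have sub : box w r `<=` box a s.
  move=> z /za zs; apply/boxP; apply: le_trans zs _.
  by rewrite ler_pdivrMr// ler_peMr ?ler1n// ltW.
have [th1 th2 _ _] := tame_hats a s0.
have [tq _ _] := tame_reg a s w e0.
have mi : measurable_fun setT (integrand (r ^+ 2) w).
  have [//] : tame a s (integrand (r ^+ 2) w).
  rewrite /integrand; under eq_fun do rewrite [_^-1 ^+ 2]expr2.
  by apply: tameM; [exact: tameM | apply: tameM; [exact: tame_cst | exact: tameM]].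
rewrite integral_cutoff_kernel//.
apply: (@le_trans _ _ (\int[lebesgue2]_(z in box w r) (integrand (r ^+ 2) w z)%:E)%E).
  apply: (@le_trans _ _ (\int[lebesgue2]_(z in box w r) (cst ((8 * r ^+ 2)^-1)%:E z))%E).
    rewrite integral_cst// [X in (_ <= _ * X)%E](lebesgue_box w (ltW r0)) -EFinM lee_fin.
    by rewrite le_eqVlt; apply/orP; left; apply/eqP; field; rewrite gt_eqF.
  apply: ge0_le_integral => //.
  - by move=> z _; rewrite lee_fin invr_ge0 mulr_ge0// ltW.
  - by apply/measurable_EFinP; apply: measurable_funTS.
  - move=> z Bz; have := za z Bz; rewrite /sup_dist ge_max => /andP[z1 z2].
    rewrite lee_fin; have h1 := hat_ge z1; have h2 := hat_ge z2.
    have q3 : sqr_dist z w + r ^+ 2 <= 3 * r ^+ 2.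
      have /boxP zr := Bz; have := sqr_dist_le z w.
      have : sup_dist z w ^+ 2 <= r ^+ 2 by rewrite lerXn2r ?nnegrE ?sup_dist_ge0// ltW.
      by move=> u1 u2; lra.
    have q0 : 0 < sqr_dist z w + r ^+ 2 by rewrite ltr_wpDl// sqr_dist_ge0.
    apply: (@le_trans _ _ ((3 / 4) * (3 / 4) * (2 * r ^+ 2 * ((3 * r ^+ 2)^-1) ^+ 2))).
      by rewrite le_eqVlt; apply/orP; left; apply/eqP; field; rewrite gt_eqF.
    have e3 : 0 < 3 * r ^+ 2 by rewrite mulr_gt0.
    apply: ler_pM; first by rewrite mulr_ge0.
    + by rewrite mulr_ge0 ?mulr_ge0 ?exprn_ge0 ?invr_ge0 ?(ltW e3) ?(ltW e0) ?(ltW r0).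
    + by rewrite ler_pM.
    + have e2 : 0 <= 2 * r ^+ 2 by rewrite mulr_ge0// ltW.
      rewrite ler_wpM2l//.
      by rewrite lerXn2r ?nnegrE ?invr_ge0 ?(ltW q0) ?(ltW e3)// lef_pV2 ?posrE.
apply: ge0_subset_integral => //.
  by apply/measurable_EFinP; apply: measurable_funTS.
by move=> z Bz; rewrite lee_fin; apply: integrand_ge0 => //; exact: ltW.
Qed.

(** The estimate is uniform in [e] and includes [e = 0], so a single function dominates the
    regularised kernels and their limit. The case [m = 0] relies on the inverse of 0 being 0. *)
Let grad_bound (t D m e : R) : 0 <= e -> 0 <= m -> `|t| <= m -> m ^+ 2 <= D ->
  `|t / (D + e)| <= m^-1.
Proof.
move=> e0 m0 tm mD; have [m00|mn0] := eqVneq m 0.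
  have -> : t = 0 by apply/eqP; rewrite -normr_le0 -m00.
  by rewrite mul0r normr0 invr_ge0.
have mp : 0 < m by rewrite lt_def mn0.
have Dp : 0 < D + e by rewrite ltr_pwDl// (lt_le_trans _ mD)// exprn_gt0.
rewrite normrM normfV (gtr0_norm Dp) ler_pdivrMr// mulrC ler_pdivlMr//.
apply: (@le_trans _ _ (m ^+ 2)); first by rewrite expr2 ler_wpM2r.
by rewrite (le_trans mD)// lerDl.
Qed.

Lemma grad1_bound e w z : 0 <= e -> `|grad1 e w z| <= (sup_dist z w)^-1.
Proof.
move=> e0; apply: grad_bound => //; first exact: sup_dist_ge0.
- by rewrite le_max lexx.
- exact: sqr_sup_dist_le.
Qed.

Lemma grad2_bound e w z : 0 <= e -> `|grad2 e w z| <= (sup_dist z w)^-1.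
Proof.
move=> e0; apply: grad_bound => //; first exact: sup_dist_ge0.
- by rewrite le_max lexx orbT.
- exact: sqr_sup_dist_le.
Qed.

Lemma cutoff_kernel_bound e w z : 0 <= e -> box a s z ->
  `|cutoff_kernel a s e w z| <= 4 / s * (sup_dist z w)^-1.
Proof.
move=> e0 [z1 z2]; rewrite normrN (le_trans (ler_normD _ _))//.
have -> : 4 / s * (sup_dist z w)^-1 =
    2 / s * 1 * (sup_dist z w)^-1 + 1 * (2 / s) * (sup_dist z w)^-1 by ring.
have /andP[h1 h1'] := hat_bounds s0 z1; have d1 := dhat_bound s0 z1.
have /andP[h2 h2'] := hat_bounds s0 z2; have d2 := dhat_bound s0 z2.
move: (grad1 e w z) (grad2 e w z) (grad1_bound w z e0) (grad2_bound w z e0).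
move=> G1 G2 g1 g2.
rewrite !normrM [`|hat1 a s z|]ger0_norm// [`|hat2 a s z|]ger0_norm// /hat1 /hat2 /dhat1 /dhat2.
by apply: lerD; apply: ler_pM => //; rewrite ?mulr_ge0//; exact: ler_pM.
Qed.

(** Convergence holds at every [z]: at [z = w] the numerators vanish, so the kernel is 0 for every
    value of the parameter. *)
Lemma cutoff_kernel_cvg (e : nat -> R) w z :
  e @ \oo --> (0 : R) ->
  (fun n => cutoff_kernel a s (e n) w z) @ \oo --> cutoff_kernel a s 0 w z.
Proof.
move=> ecv; have [D0|Dn0] := eqVneq (sqr_dist z w) 0.
  have zw : (z.1 : R) - (w.1 : R) = 0 /\ (z.2 : R) - (w.2 : R) = 0.
    move/eqP: D0; rewrite paddr_eq0 ?sqr_ge0// !sqrf_eq0.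
    by move=> /andP[/eqP -> /eqP ->].
  case: zw => zw1 zw2.
  rewrite (_ : (fun n => _) = (fun=> cutoff_kernel a s 0 w z)); first exact: cvg_cst.
  by apply/funext => n; rewrite /cutoff_kernel /grad1 /grad2 zw1 zw2 !mul0r.
have cV : (fun n => (sqr_dist z w + e n)^-1) @ \oo --> (sqr_dist z w + 0)^-1.
  apply: cvgV; first by rewrite addr0.
  by apply: cvgD; [exact: cvg_cst | exact: ecv].
have cg (k t : R) : (fun n => k * (t / (sqr_dist z w + e n))) @ \oo -->
    k * (t / (sqr_dist z w + 0)).
  apply: cvgM; first exact: cvg_cst.
  by apply: cvgM; [exact: cvg_cst | exact: cV].
by apply: cvgN; apply: cvgD; exact: cg.
Qed.

Lemma integrable_inv_sup_dist w :
  lebesgue2.-integrable (box a s) (fun z => ((sup_dist z w)^-1)%:E).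
Proof.
apply/integrableP; split.
  apply/measurable_EFinP; apply: measurable_funTS.
  apply: measurable_funV => [|z]; last exact: sup_dist_ge0.
  exact: (measurable_fun_pair1 w (@measurable_sup_dist R)).
under eq_integral do rewrite gee0_abs ?lee_fin ?invr_ge0 ?sup_dist_ge0//.
exact: le_lt_trans (integral_inv_sup_dist a w (ltW s0)) (ltry _).
Qed.

Lemma integral_cutoff_kernel_cvg (e : nat -> R) w : (forall n, 0 < e n) ->
  e @ \oo --> (0 : R) ->
  ((fun n => \int[lebesgue2]_(z in box a s) (cutoff_kernel a s (e n) w z)%:E) @ \oo
    --> \int[lebesgue2]_(z in box a s) (cutoff_kernel a s 0 w z)%:E)%E.
Proof.
move=> e0 ecv; have mB := measurable_box a s.
have mk r : 0 <= r -> measurable_fun (box a s) (fun z => (cutoff_kernel a s r w z)%:E).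
  move=> r0; apply/measurable_EFinP; apply: measurable_funTS.
  exact: (measurable_fun_pair1 w (measurable_cutoff_kernel a s r0)).
have cv z : (fun n => (cutoff_kernel a s (e n) w z)%:E) @ \oo -->
    (cutoff_kernel a s 0 w z)%:E.
  by apply: cvg_EFin; [exact: nearW | exact: cutoff_kernel_cvg].
have [_ _ h] := @dominated_convergence _ _ _ lebesgue2 _ mB
  (fun n z => (cutoff_kernel a s (e n) w z)%:E) (fun z => (cutoff_kernel a s 0 w z)%:E)
  (fun z => ((4 / s)%:E * ((sup_dist z w)^-1)%:E)%E)
  (fun n => mk _ (ltW (e0 n))) (mk 0 (lexx 0))
  (aeW _ (fun z _ => cv z))
  (integrableZl mB _ (integrable_inv_sup_dist w))
  (aeW _ (fun z n Bz => cutoff_kernel_bound w (ltW (e0 n)) Bz)).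
exact: h.
Qed.

Lemma integral_cutoff_kernel0_ge0 w :
  (0 <= \int[lebesgue2]_(z in box a s) (cutoff_kernel a s 0 w z)%:E)%E.
Proof.
pose e n : R := n.+1%:R^-1.
have e0 n : 0 < e n by rewrite invr_gt0.
have h := integral_cutoff_kernel_cvg (w := w) e0 (@cvg_harmonic R).
refine (cvge_ge _ h).
by near=> n; exact: integral_cutoff_kernel_ge0.
Unshelve. all: by end_near.
Qed.

Lemma integral_cutoff_kernel0_ge w : sup_dist w a <= s / 4 ->
  ((2^-1)%:E <= \int[lebesgue2]_(z in box a s) (cutoff_kernel a s 0 w z)%:E)%E.
Proof.
(* The parameters are squares of radii at most [s/4], the form for which the lower bound was
   proved. *)
move=> wa; pose e n : R := (s / 4 * n.+1%:R^-1) ^+ 2.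
have e0 n : 0 < e n by rewrite exprn_gt0// !mulr_gt0// invr_gt0.
have ecv : e @ \oo --> (0 : R).
  rewrite /e; under eq_fun do rewrite expr2.
  have h : (fun n : nat => s / 4 * n.+1%:R^-1) @ \oo --> (0 : R).
    rewrite -[X in _ --> X](mulr0 (s / 4)).
    by apply: cvgM; [exact: cvg_cst | exact: (@cvg_harmonic R)].
  by have E := cvgM h h; rewrite mulr0 in E; exact: E.
have h := integral_cutoff_kernel_cvg (w := w) e0 ecv.
refine (cvge_ge _ h).
near=> n; apply: integral_cutoff_kernel_ge => //.
rewrite !mulr_gt0 ?invr_gt0//= ler_piMr ?divr_ge0 ?(ltW s0)//.
by rewrite invf_le1// ler1n.
Unshelve. all: by end_near.
Qed.

End KernelLowerBound.

(** * Local mass and the Cauchy transform *)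

Section LocalMassBound.
Variables (R : realType) (a : plane R) (s : R).
Hypothesis s0 : 0 < s.
Variable mu : {finite_measure set (plane R) -> \bar R}.
Implicit Types (z w : plane R).

(** The restriction to the box is carried by an indicator, so that Fubini can be used on the whole
    product space. *)
Let on_box (g : plane R * plane R -> R) (p : plane R * plane R) : \bar R :=
  (\1_(box a s) p.1 * g p)%:E.

Let measurable_on_box (g : plane R * plane R -> R) :
  measurable_fun setT g -> measurable_fun setT (on_box g).
Proof.
move=> mg; apply/measurable_EFinP; apply: measurable_funM => //.
have mi : measurable_fun setT (\1_(box a s) : plane R -> R).
  by apply: measurable_indic; exact: measurable_box.
exact: (measurableT_comp mi measurable_fst).
Qed.

Let integral_on_box g w :
  (\int[lebesgue2]_z on_box g (z, w) = \int[lebesgue2]_(z in box a s) (g (z, w))%:E)%E.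
Proof.
rewrite [RHS]integral_mkcond; apply: eq_integral => z _.
rewrite /on_box patchE indicE /=.
by case: (z \in box a s); rewrite ?mul1r ?mul0r.
Qed.

(** By Tonelli with [z] integrated first: the inner integral is bounded independently of [w], and
    [mu] is finite. *)
Let integrable_on_box (g : plane R * plane R -> R) (k : R) : measurable_fun setT g -> 0 <= k ->
  (forall z w, box a s z -> `|g (z, w)| <= k * (sup_dist z w)^-1) ->
  (lebesgue2 \x mu)%E.-integrable setT (on_box g).
Proof.
move=> mg k0 gk; have mB := measurable_box a s.
apply/(integrable21ltyP lebesgue2 mu (measurable_on_box mg)).
have b w : (\int[lebesgue2]_z `|on_box g (z, w)| <= (k * (4 * s ^+ 2 + 16))%:E)%E.
  have -> : (\int[lebesgue2]_z `|on_box g (z, w)| =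
      \int[lebesgue2]_(z in box a s) `|(g (z, w))%:E|)%E.
    rewrite [RHS]integral_mkcond; apply: eq_integral => z _.
    rewrite /on_box patchE indicE /=.
    by case: (z \in box a s); rewrite ?mul1r ?mul0r ?normr0.
  apply: (@le_trans _ _ (\int[lebesgue2]_(z in box a s)
      (k%:E * ((sup_dist z w)^-1)%:E))%E).
    apply: ge0_le_integral => //.
    - apply: measurable_funTS; apply/measurable_EFinP.
      apply: measurableT_comp => //; exact: (measurable_fun_pair1 w mg).
    - by apply: measurable_funeM; case/integrableP: (integrable_inv_sup_dist a s0 w).
    - by move=> z Bz; rewrite -EFinM lee_fin; exact: gk.
  rewrite integralZl//; last exact: integrable_inv_sup_dist.
  by rewrite EFinM lee_wpmul2l ?lee_fin//; exact: (integral_inv_sup_dist a w (ltW s0)).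
apply: (@le_lt_trans _ _ (\int[mu]_w (cst (k * (4 * s ^+ 2 + 16))%:E w))%E).
  apply: ge0_le_integral => //.
  - by move=> w _; apply: integral_ge0 => z _.
  - apply: (@measurable_fun_fubini_tonelli_G _ _ _ _ _ lebesgue2
      (fun p => `|on_box g p|%E)) => //.
    by apply: measurableT_comp => //; exact: measurable_on_box.
rewrite integral_cst// lte_mul_pinfty ?lee_fin//.
  by rewrite mulr_ge0// addr_ge0// mulr_ge0// sqr_ge0.
exact: fin_num_fun_lty.
Qed.

Let kern (p : plane R * plane R) := cutoff_kernel a s 0 p.2 p.1.
Let g1 (p : plane R * plane R) := grad1 0 p.2 p.1.
Let g2 (p : plane R * plane R) := grad2 0 p.2 p.1.

Lemma sup_dist_le_cabs z w : sup_dist z w <= cabs (cplx z - cplx w).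
Proof.
rewrite /sup_dist ge_max.
by rewrite (Re_le_cabs (cplx z - cplx w)) (Im_le_cabs (cplx z - cplx w)).
Qed.

Lemma Re_cauchy_kernel z w : complex.Re (cplx z - cplx w)^-1 = grad1 0 w z.
Proof. by rewrite Re_inv /grad1 addr0. Qed.

Lemma Im_cauchy_kernel z w : complex.Im (cplx z - cplx w)^-1 = - grad2 0 w z.
Proof. by rewrite Im_inv /grad2 addr0. Qed.

(** The real and imaginary parts of [1/(z-w)] are [grad1] and [- grad2] at [e = 0], so the kernel is
    a combination of them with coefficients bounded by [2/s] that do not involve [w]. Integrability
    ensures that the Cauchy transform at [z] is a true integral and not a default value. *)
Lemma integral_kern_bound z : box a s z ->
  mu.-integrable setT (fun w => (g1 (z, w))%:E) ->
  mu.-integrable setT (fun w => (g2 (z, w))%:E) ->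
  (`|\int[mu]_w (kern (z, w))%:E| <= (4 / s * cabs (cauchy_transform mu z))%:E)%E.
Proof.
move=> [z1 z2] i1 i2.
pose c1 := - (dhat1 a s z * hat2 a s z); pose c2 := - (hat1 a s z * dhat2 a s z).
have E : (\int[mu]_w (kern (z, w))%:E =
    (c1 * complex.Re (cauchy_transform mu z) -
     c2 * complex.Im (cauchy_transform mu z))%:E)%E.
  transitivity (\int[mu]_w (c1%:E * (g1 (z, w))%:E + c2%:E * (g2 (z, w))%:E))%E.
    apply: eq_integral => w _; rewrite -!EFinM -EFinD; congr EFin.
    by rewrite /kern /cutoff_kernel /c1 /c2 /g1 /g2 /= opprD !mulNr.
  rewrite integralD ?integralZl//; last 2 first.
  - exact: integrableZl.
  - exact: integrableZl.
  have -> : complex.Re (cauchy_transform mu z) = Rintegral mu setT (fun w => g1 (z, w)).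
    by rewrite /cauchy_transform /=; apply: eq_Rintegral => w _; exact: Re_cauchy_kernel.
  have -> : complex.Im (cauchy_transform mu z) = - Rintegral mu setT (fun w => g2 (z, w)).
    transitivity (Rintegral mu setT (fun w => - g2 (z, w))).
      by rewrite /cauchy_transform /=; apply: eq_Rintegral => w _; exact: Im_cauchy_kernel.
    rewrite -mulN1r -RintegralZl//.
    by apply: eq_Rintegral => w _; rewrite mulN1r.
  rewrite mulrN opprK EFinD !EFinM /Rintegral !fineK//; exact: integrable_fin_num.
rewrite E abse_EFin lee_fin.
have /andP[h1 h1'] := hat_bounds s0 z1; have d1 := dhat_bound s0 z1.
have /andP[h2 h2'] := hat_bounds s0 z2; have d2 := dhat_bound s0 z2.
have b1 : `|c1| <= 2 / s.
  by rewrite normrN normrM [`|hat2 a s z|]ger0_norm// -[leRHS]mulr1 ler_pM.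
have b2 : `|c2| <= 2 / s.
  by rewrite normrN normrM [`|hat1 a s z|]ger0_norm// -[leRHS]mul1r ler_pM.
rewrite (le_trans (ler_normB _ _))// !normrM.
have -> : 4 / s * cabs (cauchy_transform mu z) =
  2 / s * cabs (cauchy_transform mu z) + 2 / s * cabs (cauchy_transform mu z) by ring.
by rewrite lerD// ler_pM ?Re_le_cabs ?Im_le_cabs.
Qed.

(** The factor [8/s] is [4/s] from the size of the kernel, doubled because the kernel only detects
    half of the mass of the disc. *)
Lemma mass_le_integral_cauchy_transform :
  (mu (disc a (s / 4)) <=
   (8 / s)%:E * \int[lebesgue2]_(z in box a s) (cabs (cauchy_transform mu z))%:E)%E.
Proof.
have mB := measurable_box a s; have mD := measurable_disc a (s / 4).
have mk : measurable_fun setT kern := measurable_cutoff_kernel a s (lexx 0).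
have [mg1 mg2] : measurable_fun setT g1 /\ measurable_fun setT g2 :=
  measurable_grads (lexx 0).
have ik : (lebesgue2 \x mu)%E.-integrable setT (on_box kern).
  apply: (@integrable_on_box _ (4 / s)) => //; first by rewrite divr_ge0// ltW.
  by move=> z w Bz; exact: cutoff_kernel_bound.
have ig1 : (lebesgue2 \x mu)%E.-integrable setT (on_box g1).
  by apply: (@integrable_on_box _ 1) => // z w Bz; rewrite mul1r; exact: grad1_bound.
have ig2 : (lebesgue2 \x mu)%E.-integrable setT (on_box g2).
  by apply: (@integrable_on_box _ 1) => // z w Bz; rewrite mul1r; exact: grad2_bound.
have mC : measurable_fun setT (fun z => cabs (cauchy_transform mu z)).
  by apply: measurable_cabs; exact: cmeasurable_cauchy_transform.
(* Nonnegativity for every [w] allows the part of [mu] outside the disc to be dropped. *)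
have low : ((2^-1)%:E * mu (disc a (s / 4)) <=
    \int[mu]_w \int[lebesgue2]_z on_box kern (z, w))%E.
  have -> : ((2^-1)%:E * mu (disc a (s / 4)) =
      \int[mu]_w ((2^-1)%:E * (\1_(disc a (s / 4)) w)%:E))%E.
    rewrite ge0_integralZl//; last by apply/measurable_EFinP; exact: measurable_indic.
    by rewrite integral_indic// setIT.
  apply: ge0_le_integral => //.
  - by apply: measurable_funeM; apply/measurable_EFinP; exact: measurable_indic.
  - exact: (measurable_fubini_G ik).
  - move=> w _; rewrite integral_on_box indicE.
    have [wD|wD] := boolP (w \in disc a (s / 4)).
      rewrite mule1; apply: integral_cutoff_kernel0_ge => //.
      rewrite (le_trans (sup_dist_le_cabs _ _))//.
      by move: wD; rewrite inE => /ltW.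
    by rewrite mule0; exact: integral_cutoff_kernel0_ge0.
have up : (\int[lebesgue2]_z \int[mu]_w on_box kern (z, w) <=
   \int[lebesgue2]_(z in box a s) (4 / s * cabs (cauchy_transform mu z))%:E)%E.
  apply: (@le_trans _ _ (\int[lebesgue2]_z `|\int[mu]_w on_box kern (z, w)|)%E).
    apply: (le_trans (lee_abs _)); apply: le_abse_integral => //.
    exact: (measurable_fubini_F ik).
  rewrite [leRHS]integral_mkcond.
  have b0 z : (0 <= ((fun z => (4 / s * cabs (cauchy_transform mu z))%:E) \_ (box a s)) z)%E.
    by rewrite patchE; case: ifP => // _; rewrite lee_fin mulr_ge0 ?cabs_ge0// divr_ge0// ltW.
  apply: ae_ge0_le_integral => //.
  - apply: measurableT_comp => //; exact: (measurable_fubini_F ik).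
  - apply/(measurable_restrictT _ mB); apply: measurable_funTS.
    by apply/measurable_EFinP; apply: measurable_funM.
  (* Fubini for the two gradient components gives integrable slices for almost every [z], which is
     enough to compare integrals over [z]. *)
  - have := ae_integrable1 ig2; apply: filterS2 (ae_integrable1 ig1) => z j1 j2 _.
    rewrite patchE; case: ifP => zB; last first.
      rewrite integral0_eq ?abse0// => w _.
      by rewrite /on_box indicE zB mul0r.
    have E g : (fun w => on_box g (z, w)) = (fun w => (g (z, w))%:E).
      by apply/funext => w; rewrite /on_box indicE zB mul1r.
    rewrite E in j1; rewrite E in j2; rewrite E.
    by apply: integral_kern_bound => //; move: zB; rewrite inE.
have h : ((2^-1)%:E * mu (disc a (s / 4)) <=
   \int[lebesgue2]_(z in box a s) (4 / s * cabs (cauchy_transform mu z))%:E)%E.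
  by apply: le_trans low _; rewrite -(Fubini ik).
have -> : mu (disc a (s / 4)) = (2%:E * ((2^-1)%:E * mu (disc a (s / 4))))%E.
  by rewrite muleA -EFinM mulfV// mul1e.
have -> : ((8 / s)%:E * \int[lebesgue2]_(z in box a s) (cabs (cauchy_transform mu z))%:E =
   2%:E * \int[lebesgue2]_(z in box a s) (4 / s * cabs (cauchy_transform mu z))%:E)%E.
  under [in RHS]eq_integral do rewrite EFinM.
  rewrite ge0_integralZl//.
  - by rewrite muleA -EFinM; congr (_%:E * _)%E; ring.
  - by apply: measurable_funTS; apply/measurable_EFinP.
  - by move=> z _; rewrite lee_fin cabs_ge0.
  - by rewrite lee_fin divr_ge0// ltW.
by rewrite lee_wpmul2l.
Qed.

End LocalMassBound.

(** * The Cauchy transform off the support *)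

Section PlaneTopology.
Variable R : realType.
Implicit Types (K : set (plane R)) (z w p : plane R).

Lemma compact_plane_closed_box K z : compact_plane K -> ~ K z ->
  exists e : R, 0 < e /\ forall w, sup_dist w z < e -> ~ K w.
Proof.
move=> cK nKz; have clK : closed (K : set (R * R)%type).
  apply: compact_closed => //; exact: norm_hausdorff.
have : open (~` (K : set (R * R)%type)) by exact: closed_openC.
rewrite openE => /(_ z nKz); rewrite /interior => /nbhs_ballP[e /= e0 eK].
exists e; split=> // w we; apply: eK; rewrite /ball /=.
by move: we; rewrite sup_distC /sup_dist gt_max => /andP[].
Qed.

(** The sigma-algebra of the plane is a product one, so the open complement of [K] is written as a
    countable union of boxes with rational centres. *)
Lemma compact_plane_measurable K : compact_plane K -> measurable K.
Proof.
move=> cK; rewrite -(setCK K); apply: measurableC.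
pose F (i : rat * rat * nat) : set (plane R) :=
  box ((ratr i.1.1 : R), (ratr i.1.2 : R)) (i.2.+1%:R^-1).
pose G i := if `[< F i `<=` ~` K >] then F i else set0.
have -> : ~` K = \bigcup_i G i.
  apply/seteqP; split=> z; last first.
    by move=> [i _]; rewrite /G; case: asboolP => // + Fz; exact.
  move=> /(compact_plane_closed_box cK)[e [e0 eK]].
  (* A box of half-side below [e/2] that contains [z] lies within distance [e] of [z], hence misses
     [K]. *)
  have [n n2] : exists n : nat, n.+1%:R^-1 < e / 2.
    have e2 : 0 < e / 2 by rewrite divr_gt0.
    by have [N _ /(_ N (leqnn N))] := near_infty_natSinv_lt (PosNum e2); exists N.
  have n0 : 0 < n.+1%:R^-1 :> R by rewrite invr_gt0.
  have h (c : R) : exists q : rat, `|c - ratr q| < n.+1%:R^-1.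
    have [|q] := @rat_in_itvoo R (c - n.+1%:R^-1) (c + n.+1%:R^-1).
      by rewrite ltrD2l gtrN.
    by rewrite in_itv/= -ltr_distl distrC => ?; exists q.
  have [p pz] := h z.1; have [q qz] := h z.2.
  have zF : F (p, q, n) z.
    by apply/boxP; rewrite /sup_dist/= ge_max (ltW pz) (ltW qz).
  exists (p, q, n) => //; rewrite /G; case: asboolP => // -[] w /boxP wF.
  apply: eK; apply: le_lt_trans (sup_dist_triangle w (ratr p, ratr q) z) _.
  have zF' : sup_dist (ratr p, ratr q) z <= n.+1%:R^-1 by rewrite sup_distC; exact/boxP.
  have wF' : sup_dist w (ratr p, ratr q) <= n.+1%:R^-1 := wF.
  by rewrite [e]splitr; apply: ltrD; [exact: le_lt_trans wF' n2 | exact: le_lt_trans zF' n2].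
apply: countable_bigcupT_measurable; first exact: countableP.
by move=> i; rewrite /G; case: ifP => // _; exact: measurable_box.
Qed.

Lemma compact_plane_bounded K : compact_plane K ->
  exists B : R, 0 < B /\ forall z, K z -> cabs (cplx z) <= B.
Proof.
move=> /compact_bounded[M [_ hM]].
exists (2 * (`|M| + 1)); split; first by rewrite mulr_gt0// ltr_wpDl.
move=> z /(hM (`|M| + 1)); rewrite ltr_pwDr ?ler_norm// => /(_ isT).
rewrite /= => zM.
have [z1 z2] : `|z.1 : R| <= `|M| + 1 /\ `|z.2 : R| <= `|M| + 1.
  by move: zM; rewrite [X in X <= _](_ : _ = Num.max `|z.1 : R| `|z.2 : R|)// ge_max => /andP.
apply: le_trans (cabs_le_ReIm _) _.
by rewrite mulr_natl mulr2n; exact: lerD.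
Qed.

Lemma cabs_le_sup_dist z w : cabs (cplx z - cplx w) <= 2 * sup_dist z w.
Proof.
apply: le_trans (cabs_le_ReIm _) _; rewrite mulr_natl mulr2n.
by apply: lerD; rewrite le_max lexx ?orbT.
Qed.

Lemma local_lipschitz_continuous (f : plane R -> R) :
  (forall z, exists L : R, 0 < L /\
     forall w, sup_dist w z <= 1 -> `|f z - f w| <= L * cabs (cplx z - cplx w)) ->
  continuous (f : (R * R)%type -> R).
Proof.
move=> fL z; apply/cvgrPdist_lt => e e0; have [L [L0 fzL]] := fL z.
have d0 : 0 < Num.min 1 (e / (2 * L)) by rewrite lt_min ltr01 divr_gt0// mulr_gt0.
set d := Num.min _ _ in d0.
exists (ball (z.1 : R) d, ball (z.2 : R) d); first by split; exact: nbhsx_ballx.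
move=> w [w1 w2] /=; have : sup_dist z w < d by rewrite /sup_dist gt_max; apply/andP.
rewrite lt_min => /andP[zw1 zwe].
apply: le_lt_trans (fzL w _) _; first by rewrite sup_distC ltW.
have := cabs_le_sup_dist z w; rewrite -(ler_pM2l L0) => /le_lt_trans; apply.
have L2 : 0 < 2 * L by rewrite mulr_gt0.
move: zwe; rewrite ltr_pdivlMr// => h.
by have -> : L * (2 * sup_dist z w) = sup_dist z w * (2 * L) by ring.
Qed.

Lemma compact_plane_min K (f : plane R -> R) : compact_plane K -> K !=set0 ->
  continuous (f : (R * R)%type -> R) ->
  exists z, K z /\ forall w, K w -> f z <= f w.
Proof.
move=> cK K0 cf.
have [z] := @compact_EVT_min (R * R)%type R f K K0 cK (continuous_subspaceT cf).
rewrite inE => Kz zmin; exists z; split=> // w Kw.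
by apply: zmin; rewrite inE.
Qed.

Lemma convex_planeP K : convex_plane K -> forall z w (t : R), K z -> K w ->
  0 <= t <= 1 -> K (t * (z.1 : R) + (1 - t) * (w.1 : R), t * (z.2 : R) + (1 - t) * (w.2 : R)).
Proof.
move=> cK z w t Kz Kw /andP[t0 t1].
pose k : {i01 R} := Itv01 t0 t1.
have := cK z w k; rewrite !inE => /(_ Kz Kw); exact.
Qed.

End PlaneTopology.

(** * Power series of the Cauchy transform on discs free of the support *)

Section IntegralOnSupport.
Variables (R : realType) (K : set (plane R)).
Variable mu : {finite_measure set (plane R) -> \bar R}.
Hypotheses (mK : measurable K) (muK : mu (~` K) = 0%E).
Implicit Types (g h : plane R -> R[i]) (z w : plane R) (c t : R[i]).

(** Integrating over [K] instead of the plane lets bounds valid on [K] alone give integrability: the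
    Cauchy kernel is bounded on [K] but not on the plane. *)
Definition support_integral g : R[i] :=
  (Rintegral mu K (fun x => complex.Re (g x)) +i*
   Rintegral mu K (fun x => complex.Im (g x)))%C.

Definition cbounded g := cmeasurable g /\
  exists B : R, forall w, K w -> cabs (g w) <= B.

Lemma Rintegral_support (f : plane R -> R) : measurable_fun setT f ->
  Rintegral mu setT f = Rintegral mu K f.
Proof.
move=> mf; rewrite /Rintegral; congr fine.
rewrite [RHS]integral_mkcond; apply: ae_eq_integral => //.
- exact/measurable_EFinP.
- apply/(measurable_restrictT _ mK); apply: measurable_funTS.
  exact/measurable_EFinP.
- exists (~` K); split => //; first exact: measurableC.
  move=> z /= nz Kz; apply: nz => _.
  by rewrite patchE mem_set.
Qed.

Lemma cauchy_transform_support z :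
  cauchy_transform mu z = support_integral (fun w => (cplx z - cplx w)^-1).
Proof.
have [m1 m2] : cmeasurable (fun w => (cplx z - cplx w)^-1).
  have [m1 m2] := cmeasurableV (@cmeasurable_sub_cplx R).
  by split; [exact: (measurable_fun_pair2 z m1) | exact: (measurable_fun_pair2 z m2)].
by rewrite /cauchy_transform /cintegral !Rintegral_support.
Qed.

Lemma bounded_support_integrable (f : plane R -> R) (B : R) :
  measurable_fun setT f -> (forall w, K w -> `|f w| <= B) ->
  mu.-integrable K (EFin \o f).
Proof.
move=> mf fB; apply: measurable_bounded_integrable => //.
- by rewrite ltey_eq fin_num_measure.
- exact: measurable_funTS.
- exists B; split; first exact: num_real.
  by move=> N BN w Kw /=; exact: le_trans (fB w Kw) (ltW BN).
Qed.

Lemma cbounded_integrable g : cbounded g ->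
  mu.-integrable K (EFin \o (fun w => complex.Re (g w))) /\
  mu.-integrable K (EFin \o (fun w => complex.Im (g w))).
Proof.
move=> [[m1 m2] [B gB]].
split; apply: (@bounded_support_integrable _ B) => // w Kw.
  exact: le_trans (Re_le_cabs _) (gB w Kw).
exact: le_trans (Im_le_cabs _) (gB w Kw).
Qed.

Lemma cboundedD g h : cbounded g -> cbounded h -> cbounded (fun w => g w + h w).
Proof.
move=> [mg [B gB]] [mh [B' hB]]; split; first exact: cmeasurableD.
by exists (B + B') => w Kw; rewrite (le_trans (ler_cabsD _ _))// lerD ?gB ?hB.
Qed.

Lemma cboundedM g h : cbounded g -> cbounded h -> cbounded (fun w => g w * h w).
Proof.
move=> [mg [B gB]] [mh [B' hB]]; split; first exact: cmeasurableM.
by exists (B * B') => w Kw; rewrite cabsM ler_pM ?cabs_ge0 ?gB ?hB.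
Qed.

Lemma cbounded_cst c : cbounded (fun=> c).
Proof. by split; [exact: cmeasurable_cst | exists (cabs c)]. Qed.

Lemma support_integralD g h : cbounded g -> cbounded h ->
  support_integral (fun w => g w + h w) = support_integral g + support_integral h.
Proof.
move=> /cbounded_integrable[g1 g2] /cbounded_integrable[h1 h2].
apply/eqP; rewrite eq_complex /=; apply/andP; split; apply/eqP.
  rewrite -RintegralD//; apply: eq_Rintegral => w _.
  by case: (g w) => ? ?; case: (h w).
rewrite -RintegralD//; apply: eq_Rintegral => w _.
by case: (g w) => ? ?; case: (h w).
Qed.

Lemma support_integralZ c g : cbounded g ->
  support_integral (fun w => c * g w) = c * support_integral g.
Proof.
move=> /cbounded_integrable[g1 g2]; case: c => x y.
have Z (k : R) f : mu.-integrable K (EFin \o f) ->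
    mu.-integrable K (EFin \o (fun w => k * f w)).
  by move=> fi; exact: (integrableZl mK k fi).
apply/eqP; rewrite eq_complex /=; apply/andP; split; apply/eqP.
  rewrite -!RintegralZl// -RintegralB//; [|exact: Z..].
  by apply: eq_Rintegral => w _; case: (g w).
rewrite -!RintegralZl// -RintegralD//; [|exact: Z..].
by apply: eq_Rintegral => w _; case: (g w).
Qed.

Lemma support_integral_sum N (c : 'I_N -> R[i]) (g : 'I_N -> plane R -> R[i]) :
  (forall i, cbounded (g i)) ->
  support_integral (fun w => \sum_(i < N) c i * g i w) =
    \sum_(i < N) c i * support_integral (g i) /\
  cbounded (fun w => \sum_(i < N) c i * g i w).
Proof.
elim: N c g => [|N IH] c g gb.
  rewrite big_ord0; under eq_fun do rewrite big_ord0.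
  split; last exact: cbounded_cst.
  have := support_integralZ 0 (cbounded_cst 0).
  by under eq_fun do rewrite mul0r; rewrite mul0r.
under eq_fun do rewrite big_ord_recr /=.
rewrite big_ord_recr /=.
have [E b] := IH (fun i => c (widen_ord (leqnSn N) i))
  (fun i => g (widen_ord (leqnSn N) i)) (fun i => gb _).
have b' : cbounded (fun w => c ord_max * g ord_max w).
  by apply: cboundedM => //; exact: cbounded_cst.
split; last exact: cboundedD.
by rewrite support_integralD// E support_integralZ.
Qed.

(** The factor 2 comes from estimating the real and imaginary parts separately. *)
Lemma cabs_support_integral g (B : R) : cmeasurable g ->
  (forall w, K w -> cabs (g w) <= B) ->
  cabs (support_integral g) <= 2 * (B * fine (mu K)).
Proof.
move=> mg gB.
have [i1 i2] : _ /\ _ := cbounded_integrable (conj mg (ex_intro _ B gB)).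
have b f : mu.-integrable K (EFin \o f) -> (forall w, K w -> `|f w| <= B) ->
    `|Rintegral mu K f| <= B * fine (mu K).
  move=> fi fB; apply: le_trans (le_normr_Rintegral mK fi) _.
  rewrite -(Rintegral_cst _ mK); apply: le_Rintegral => //.
  - exact: integrable_norm.
  - exact: finite_measure_integrable_cst.
apply: le_trans (cabs_le_ReIm _) _; rewrite mulr_natl mulr2n /=.
apply: lerD; apply: b => // w Kw.
  exact: le_trans (Re_le_cabs _) (gB w Kw).
exact: le_trans (Im_le_cabs _) (gB w Kw).
Qed.

(** Finite geometric sum with its exact remainder, so that it can be integrated term by term without
    a limit. *)
Lemma geometric_inverse (u t : R[i]) N : u != 0 -> t + u != 0 ->
  (t + u)^-1 = \sum_(n < N) (- t) ^+ n * u^-1 ^+ n.+1 +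
    (- t) ^+ N * (u^-1 ^+ N * (t + u)^-1).
Proof.
move=> u0 tu0; elim: N => [|N IH].
  by rewrite big_ord0 !expr0 !mul1r add0r.
rewrite [LHS]IH big_ord_recr /= -addrA; congr (_ + _).
have E : (t + u)^-1 = u^-1 - t * u^-1 * (t + u)^-1 by field; rewrite ?u0 ?tu0.
rewrite {1}E !exprS; ring.
Qed.

Variables (c : R[i]) (rho r : R).
Hypotheses (r0 : 0 < r) (r_rho : r < rho).
Hypothesis far : forall w, K w -> rho <= cabs (c - cplx w).

(** For [w] in [K] the kernel is expanded in powers of [t/(c-w)], where [|t| <= r < rho <= |c-w|];
    the gap [rho - r] bounds the remaining denominator from below. *)
Lemma power_expansion_cauchy_transform :
  power_expansion r (fun t => support_integral (fun w => (c + t - cplx w)^-1)).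
Proof.
have rho0 : 0 < rho by exact: lt_trans r_rho.
have d0 : 0 < rho - r by rewrite subr_gt0.
set m := fine (mu K); have m0 : 0 <= m by rewrite fine_ge0.
have mc t : cmeasurable (fun w => t - cplx w).
  have := cmeasurableD (cmeasurable_cst _ t)
    (cmeasurableM (cmeasurable_cst _ (-1)) (@cmeasurable_cplx R)).
  by under eq_fun do rewrite mulN1r.
have pb n : forall w, K w -> cabs ((c - cplx w)^-1 ^+ n) <= rho^-1 ^+ n.
  move=> w Kw; rewrite cabsX cabsV lerXn2r ?nnegrE ?invr_ge0 ?cabs_ge0 ?(ltW rho0)//.
  by rewrite lef_pV2 ?posrE ?far//; exact: lt_le_trans (far Kw).
have pbd n : cbounded (fun w => (c - cplx w)^-1 ^+ n).
  split; first by apply: cmeasurable_exp; exact: cmeasurableV.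
  by exists (rho^-1 ^+ n); exact: pb.
exists (fun n => (-1) ^+ n * support_integral (fun w => (c - cplx w)^-1 ^+ n.+1)).
(* One constant serves twice: it sums the majorants [2 (m/rho) (r/rho)^n] of the coefficients, and
   it bounds the remainder, whose last factor is at most [1/(rho-r)]. *)
exists (2 * ((rho - r)^-1 * m)); split.
- by rewrite !mulr_ge0 ?invr_ge0 ?(ltW d0).
- move=> N; apply: (@le_trans _ _
      (\sum_(n < N) 2 * (rho^-1 * m) * (r / rho) ^+ n)).
    apply: ler_sum => n _.
    rewrite cabsM cabsX cabsN cabs1 expr1n mul1r expr_div_n.
    apply: (@le_trans _ _ (2 * (rho^-1 ^+ n.+1 * m) * r ^+ n)).
      rewrite ler_wpM2r ?exprn_ge0 ?(ltW r0)//; apply: cabs_support_integral.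
        by case: (pbd n.+1).
      exact: pb.
    by rewrite exprS -exprVn le_eqVlt; apply/orP; left; apply/eqP; ring.
  rewrite -mulr_sumr; set q := r / rho.
  have q1 : q < 1 by rewrite ltr_pdivrMr// mul1r.
  have q0 : 0 <= q by rewrite divr_ge0// ltW.
  have S : (1 - q) * \sum_(n < N) q ^+ n <= 1.
    rewrite -opprB mulNr -subrX1 opprB.
    by rewrite gerBl exprn_ge0.
  have -> : (rho - r)^-1 = rho^-1 * (1 - q)^-1.
    by rewrite /q; field; rewrite !gt_eqF.
  have {}S : \sum_(n < N) q ^+ n <= (1 - q)^-1.
    by rewrite -div1r ler_pdivlMr ?subr_gt0// mulrC.
  have -> : 2 * (rho^-1 * (1 - q)^-1 * m) = 2 * (rho^-1 * m) * (1 - q)^-1 by ring.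
  by rewrite ler_wpM2l// !mulr_ge0// invr_ge0 ltW.
- move=> t N tr.
  have low w : K w -> rho - r <= cabs (t + (c - cplx w)).
    move=> Kw; have := lerB_cabs (c - cplx w) (- t).
    by rewrite opprK cabsN [_ + t]addrC; have := far Kw; lra.
  have n0 w : K w -> c - cplx w != 0 /\ t + (c - cplx w) != 0.
    move=> Kw; rewrite -!cabs_gt0; split; first exact: lt_le_trans (far Kw).
    exact: lt_le_trans (low w Kw).
  pose rest w := (- t) ^+ N * ((c - cplx w)^-1 ^+ N * (t + (c - cplx w))^-1).
  have mrest : cmeasurable rest.
    apply: cmeasurableM; first exact: cmeasurable_cst.
    apply: cmeasurableM; first by case: (pbd N).
    by apply: cmeasurableV; under eq_fun do rewrite addrA; exact: mc.
  have rb w : K w -> cabs (rest w) <= (cabs t / r) ^+ N * (rho - r)^-1.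
    move=> Kw; rewrite !cabsM cabsX cabsN mulrA ler_pM ?mulr_ge0 ?exprn_ge0 ?cabs_ge0//.
      rewrite expr_div_n ler_wpM2l ?exprn_ge0 ?cabs_ge0//.
      apply: le_trans (pb N w Kw) _; rewrite -exprVn.
      by rewrite lerXn2r ?nnegrE ?invr_ge0 ?(ltW r0) ?(ltW rho0)// lef_pV2 ?posrE ?ltW.
    by rewrite cabsV lef_pV2 ?posrE ?low//; exact: lt_le_trans (low w Kw).
  have brest : cbounded rest by split=> //; exists ((cabs t / r) ^+ N * (rho - r)^-1).
  have [E b] := @support_integral_sum N (fun n => (- t) ^+ n)
     (fun n w => (c - cplx w)^-1 ^+ n.+1) (fun n => pbd n.+1).
  have -> : support_integral (fun w => (c + t - cplx w)^-1) =
      support_integral (fun w => \sum_(n < N) (- t) ^+ n * (c - cplx w)^-1 ^+ n.+1 + rest w).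
    congr (_ +i* _)%C; apply: eq_Rintegral => w; rewrite inE => Kw;
    have [w1 w2] := n0 w Kw; by rewrite -geometric_inverse// addrA [t + c]addrC.
  rewrite support_integralD// E.
  have -> : \sum_(i < N) (- t) ^+ i * support_integral (fun w => (c - cplx w)^-1 ^+ i.+1) =
     \sum_(n < N) (-1) ^+ n * support_integral (fun w => (c - cplx w)^-1 ^+ n.+1) * t ^+ n.
    by apply: eq_bigr => n _; rewrite [in LHS]exprNn mulrAC.
  rewrite [X in cabs (X - _)]addrC addrK.
  apply: le_trans (cabs_support_integral mrest rb) _.
  by rewrite -/m -[leRHS]mulrA ler_wpM2l// -mulrA mulrC.
Qed.

End IntegralOnSupport.

(** * Vanishing outside the convex set, and the bound on the total mass *)

Section OffSupport.
Variables (R : realType) (K : set (plane R)).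
Hypotheses (cK : compact_plane K) (convK : convex_plane K).
Implicit Types (z w p : plane R).

Lemma sqr_cabs_sub z w : cabs (cplx z - cplx w) ^+ 2 =
  ((z.1 : R) - (w.1 : R)) ^+ 2 + ((z.2 : R) - (w.2 : R)) ^+ 2.
Proof. by rewrite sqr_cabs. Qed.

Lemma continuous_cabs_sub (z : plane R) :
  continuous ((fun w : plane R => cabs (cplx w - cplx z)) : (R * R)%type -> R).
Proof.
apply: local_lipschitz_continuous => w; exists 1; split=> // v _; rewrite mul1r.
rewrite ler_norml; apply/andP; split.
  rewrite lerNl opprB lerBlDr addrC [cabs (cplx w - cplx v)]cabsBC addrC.
  exact: ler_cabs_distD.
by rewrite lerBlDr; exact: ler_cabs_distD.
Qed.

(* The ray leaving [K] through [z] in the direction [z - p], with [p] the point of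
   [K] closest to [z]. *)
Lemma exists_far_center (z : plane R) (N : R) : ~ K z -> exists (c : R[i]) (rho : R),
  [/\ forall w, K w -> rho <= cabs (c - cplx w), cabs (cplx z - c) < rho &
      N < cabs c].
Proof.
move=> nKz; set n := cabs (cplx z).
have n0 : 0 <= n by exact: cabs_ge0.
have [K0|/set0P K0] := eqVneq K set0.
  exists (`|N| + 1)%:C%C, (cabs (cplx z - (`|N| + 1)%:C%C) + 1); split.
  - by move=> w; rewrite K0.
  - by rewrite ltrDl.
  - by rewrite cabs_real ger0_norm ?addr_ge0// ltr_pwDr// ler_norm.
have [p [Kp pmin]] := compact_plane_min cK K0 (@continuous_cabs_sub z).
set d := cabs (cplx z - cplx p).
have d0 : 0 < d.
  rewrite cabs_gt0 subr_eq0; apply/eqP => zp; apply: nKz.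
  by move: zp => [zp1 zp2]; rewrite [z]surjective_pairing zp1 zp2 -surjective_pairing.
pose u1 := (z.1 : R) - (p.1 : R); pose u2 := (z.2 : R) - (p.2 : R).
have dE : d ^+ 2 = u1 ^+ 2 + u2 ^+ 2 by exact: sqr_cabs_sub.
(* Variational inequality for the nearest point: with a positive scalar product, a short move from
   [p] towards [w], inside [K] by convexity, would come closer to [z]. *)
have obtuse w : K w -> ((w.1 : R) - (p.1 : R)) * u1 + ((w.2 : R) - (p.2 : R)) * u2 <= 0.
  move=> Kw; rewrite leNgt; apply/negP.
  set v1 := (w.1 : R) - _; set v2 := (w.2 : R) - _; set X := _ + _ => X0.
  set Y := v1 ^+ 2 + v2 ^+ 2.
  have Y0 : 0 <= Y by rewrite addr_ge0 ?sqr_ge0.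
  (* The squared distance changes by [t (t Y - 2 X)], which is negative as soon as [t Y <= X]. *)
  set t := Num.min 1 (X / (Y + 1)).
  have Y1 : 0 < Y + 1 by rewrite ltr_wpDl.
  have t0 : 0 < t by rewrite lt_min ltr01 divr_gt0.
  have t1 : t <= 1 by rewrite ge_min lexx.
  have tY : t * (Y + 1) <= X by rewrite -ler_pdivlMr// ge_min lexx orbT.
  have t01 : 0 <= t <= 1 by rewrite (ltW t0).
  have := pmin _ (convex_planeP convK Kw Kp t01).
  rewrite -(@ler_pXn2r _ 2)// ?nnegrE ?cabs_ge0// !sqr_cabs_sub /=.
  have -> : t * (w.1 : R) + (1 - t) * (p.1 : R) - (z.1 : R) = t * v1 - u1.
    by rewrite /v1 /u1; ring.
  have -> : t * (w.2 : R) + (1 - t) * (p.2 : R) - (z.2 : R) = t * v2 - u2.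
    by rewrite /v2 /u2; ring.
  have -> : ((p.1 : R) - (z.1 : R)) ^+ 2 + ((p.2 : R) - (z.2 : R)) ^+ 2 =
    u1 ^+ 2 + u2 ^+ 2 by rewrite /u1 /u2; ring.
  have -> : (t * v1 - u1) ^+ 2 + (t * v2 - u2) ^+ 2 =
    u1 ^+ 2 + u2 ^+ 2 + t * (t * Y - 2 * X) by rewrite /Y /X; ring.
  rewrite lerDl pmulr_rge0// subr_ge0 => h.
  by move: tY; rewrite mulrDr mulr1; move: (t * Y) h => q h; lra.
(* A centre at distance [s] from [z] has modulus at least [s - |z|], hence beyond [N]. *)
pose s := `|N| + n + 1.
have s0 : 0 < s by rewrite ltr_wpDl ?addr_ge0.
pose c : R[i] := cplx (((z.1 : R) + s * u1 / d, (z.2 : R) + s * u2 / d) : plane R).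
have zc : cabs (cplx z - c) = s.
  apply/eqP; rewrite -(@eqrXn2 _ 2) ?cabs_ge0 ?(ltW s0)// sqr_cabs_sub /=.
  have -> : ((z.1 : R) - ((z.1 : R) + s * u1 / d)) ^+ 2 +
     ((z.2 : R) - ((z.2 : R) + s * u2 / d)) ^+ 2 = s ^+ 2 * (u1 ^+ 2 + u2 ^+ 2) / d ^+ 2.
    by field; rewrite gt_eqF.
  by rewrite -dE mulfK// expf_neq0// gt_eqF.
exists c, (s + d); split; last 2 first.
- by rewrite zc ltrDl.
- have := lerB_cabs (cplx z - c) (cplx z).
  rewrite [cplx z - c - cplx z]addrAC subrr sub0r cabsN zc => /(lt_le_trans _); apply.
  by rewrite -/n /s; have := ler_norm N; lra.
move=> w Kw; have := obtuse w Kw.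
set v1 := (w.1 : R) - _; set v2 := (w.2 : R) - _ => ob.
rewrite -(@ler_pXn2r _ 2)// ?nnegrE ?cabs_ge0 ?addr_ge0 ?(ltW s0) ?(ltW d0)//.
rewrite sqr_cabs_sub /=.
set x1 := (z.1 : R) + _ - _; set x2 := (z.2 : R) + _ - _.
have x1E : x1 = (1 + s / d) * u1 - v1 by rewrite /x1 /u1 /v1; field; rewrite gt_eqF.
have x2E : x2 = (1 + s / d) * u2 - v2 by rewrite /x2 /u2 /v2; field; rewrite gt_eqF.
(* The distance from [c] to [w] is at least its projection on the direction [u]; by [obtuse] that
   projection is at least [s + d]. *)
have CS : (x1 * u1 + x2 * u2) ^+ 2 <= (x1 ^+ 2 + x2 ^+ 2) * d ^+ 2.
  by rewrite dE; have := sqr_ge0 (x1 * u2 - x2 * u1); lra.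
have low : (s + d) * d <= x1 * u1 + x2 * u2.
  have -> : x1 * u1 + x2 * u2 = (1 + s / d) * d ^+ 2 - (v1 * u1 + v2 * u2).
    by rewrite dE x1E x2E; ring.
  have -> : (1 + s / d) * d ^+ 2 = (s + d) * d by field; rewrite gt_eqF.
  by rewrite lerDl oppr_ge0.
rewrite -(@ler_pM2r _ (d ^+ 2)) ?exprn_gt0//.
have p1 : 0 <= (s + d) * d by rewrite mulr_ge0 ?addr_ge0 ?(ltW s0) ?(ltW d0).
by apply: le_trans CS; rewrite -exprMn lerXn2r// nnegrE//; exact: le_trans low.
Qed.

Variable mu : {finite_measure set (plane R) -> \bar R}.
Variable f : R[i] -> R[i].
Hypothesis germ : germ_measures f K mu.

Let mK : measurable K := compact_plane_measurable cK.
Let muK : mu (~` K) = 0%E := germ.1.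

Lemma eval_cauchy_transform_off_support (P : {poly {poly R[i]}}) (z : plane R) :
  near_infinity (fun x => eval_zw P x (f x) = 0) -> ~ K z ->
  eval_zw P (cplx z) (cauchy_transform mu z) = 0.
Proof.
move=> [N1 PN1] nKz; have [_ [N2 CN2]] := germ.
have [c [rho [far zc Nc]]] := exists_far_center (Num.max N1 N2) nKz.
(* The midpoint leaves room on both sides: [z] is strictly inside the disc of radius [r], and
   [r < rho] as the expansion requires. *)
set r := (cabs (cplx z - c) + rho) / 2.
have zr : cabs (cplx z - c) < r by rewrite /r ltr_pdivlMr//; lra.
have rrho : r < rho by rewrite /r ltr_pdivrMr//; lra.
have r0 : 0 < r by exact: le_lt_trans (cabs_ge0 _) zr.
have pe := power_expansion_cauchy_transform mu mK r0 rrho far.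
have := power_expansion_eval r0 P c pe.
(* Within this distance of [c] a point is still far enough out for the transform to equal [f] and
   for [f] to satisfy the equation. *)
have dl : 0 < cabs c - Num.max N1 N2 by rewrite subr_gt0.
move=> /(power_expansion_zero r0 dl) H.
rewrite (cauchy_transform_support mK muK).
have E : c + (cplx z - c) = cplx z by rewrite addrC subrK.
have HH := fun h => H h (cplx z - c) zr; rewrite E in HH; apply: HH => t ht.
have ct : Num.max N1 N2 < cabs (c + t).
  have := lerB_cabs c (- t); rewrite opprK cabsN; move: ht; lra.
pose x : plane R := (complex.Re (c + t), complex.Im (c + t)).
have xE : cplx x = c + t by rewrite /cplx /x /=; case: (c + t).
have := CN2 x; rewrite xE (cauchy_transform_support mK muK) xE => ->.
  by apply: PN1; apply: le_lt_trans ct; rewrite le_max lexx.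
by apply: le_lt_trans ct; rewrite le_max lexx orbT.
Qed.

(* Compares the real parts of [C_mu(t)] and [a_0/t] as the real number [t] grows. *)
Lemma mass_le_leading_coef (a0 : R) : 0 < a0 -> leading_at_infinity f a0 ->
  fine (mu setT) <= a0.
Proof.
move=> a00 [M [N1 fN1]]; have [_ [N2 CN2]] := germ.
have [B [B0 KB]] := compact_plane_bounded cK.
set m := fine (mu setT); have m0 : 0 <= m by rewrite fine_ge0.
have mE : fine (mu K) = m.
  rewrite /m -[in RHS](setvU K) measureU//; last 2 first.
  - exact: measurableC.
  - by rewrite setICl.
  by congr fine; rewrite -[LHS]add0e; congr (_ + _)%E; exact/esym.
have KB' w : K w -> `|w.1 : R| <= B /\ `|w.2 : R| <= B.
  move=> Kw; have h := KB w Kw.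
  by split; [exact: le_trans (Re_le_cabs (cplx w)) h | exact: le_trans (Im_le_cabs (cplx w)) h].
(* For [w] in [K] the real part of [1/(t-w)] is at least [(t-B)/((t+B)^2+B^2)]; integrating this
   bounds the real part of the transform below by [m] times it. *)
have key (t : R) : B < t -> N1 < t -> N2 < t ->
    m * (t - B) <= ((t + B) ^+ 2 + B ^+ 2) * (a0 / t + M / t ^+ 2).
  move=> tB t1 t2; have t0 : 0 < t by exact: lt_trans tB.
  pose z : plane R := (t, 0).
  have zE : cplx z = t%:C%C by [].
  have ct : cabs (cplx z) = t by rewrite zE cabs_real gtr0_norm.
  have Cf := CN2 z; rewrite ct in Cf.
  have up : complex.Re (cauchy_transform mu z) <= a0 / t + M / t ^+ 2.
    rewrite Cf//; have := fN1 (cplx z); rewrite ct => /(_ t1) h.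
    have -> : complex.Re (f (cplx z)) =
        a0 / t + complex.Re (f (cplx z) - a0%:C%C / cplx z).
      have -> : a0%:C%C / cplx z = (a0 / t)%:C%C by rewrite zE rmorphM fmorphV.
      by case: (f _) => x y /=; rewrite addrC subrK.
    rewrite lerD2l; apply: le_trans h.
    exact: le_trans (ler_norm _) (Re_le_cabs _).
  have q0 : 0 < (t + B) ^+ 2 + B ^+ 2 by rewrite ltr_wpDr ?sqr_ge0// exprn_gt0// addr_gt0.
  have tB0 : 0 < t - B by rewrite subr_gt0.
  set q := _ + B ^+ 2 in q0 *.
  have far w : K w -> t - B <= cabs (cplx z - cplx w).
    by move=> Kw; have := lerB_cabs (cplx z) (cplx w); rewrite ct; have := KB w Kw; lra.
  have low w : K w -> (t - B) / q <= complex.Re (cplx z - cplx w)^-1.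
    move=> Kw; have [w1 w2] := KB' w Kw; rewrite Re_inv /=.
    move: w1 w2; rewrite !ler_norml => /andP[w11 w12] /andP[w21 w22].
    have n1 : t - B <= t - (w.1 : R) by lra.
    have n0 : 0 < t - (w.1 : R) by exact: lt_le_trans n1.
    have d0 : 0 < (t - (w.1 : R)) ^+ 2 + (0 - (w.2 : R)) ^+ 2.
      by rewrite ltr_wpDr ?sqr_ge0// exprn_gt0.
    apply: ler_pM => //; first exact: ltW.
    - by rewrite invr_ge0 ltW.
    - rewrite lef_pV2 ?posrE// lerD//; first by rewrite lerXn2r ?nnegrE; lra.
      by rewrite -real_normK ?num_real// lerXn2r ?nnegrE ?(ltW B0)// sub0r normrN ler_norml w21.
  have mz : cmeasurable (fun w => (cplx z - cplx w)^-1).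
    have [m1 m2] := cmeasurableV (@cmeasurable_sub_cplx R).
    by split; [exact: (measurable_fun_pair2 z m1) | exact: (measurable_fun_pair2 z m2)].
  have : (t - B) / q * fine (mu K) <= complex.Re (cauchy_transform mu z).
    rewrite (cauchy_transform_support mK muK) /= -(Rintegral_cst _ mK).
    apply: le_Rintegral => //; first exact: finite_measure_integrable_cst.
    apply: (@bounded_support_integrable _ _ _ mK _ (t - B)^-1); first by case: mz.
    move=> w Kw; apply: le_trans (Re_le_cabs (cplx z - cplx w)^-1) _.
    by rewrite cabsV lef_pV2 ?posrE ?far//; exact: lt_le_trans (far w Kw).
  move=> /le_trans/(_ up); rewrite mE mulrAC ler_pdivrMr//.
  by rewrite mulrC [_ * q]mulrC.
rewrite leNgt; apply/negP => am.
(* After the terms [a0 t^3] cancel, what remains of [key] is at most [C t^2] for [t >= 1]. If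
   [m > a0], then [(m - a0) t^3] exceeds this once [t > C/(m - a0)]. *)
pose C := m * B + `|M| + (2 * B + 2 * B ^+ 2) * (a0 + `|M|).
have C0 : 0 <= C.
  by rewrite !addr_ge0 ?mulr_ge0 ?addr_ge0 ?mulr_ge0 ?sqr_ge0 ?(ltW B0) ?(ltW a00).
pose t := 1 + B + `|N1| + `|N2| + C / (m - a0).
have ma : 0 < m - a0 by rewrite subr_gt0.
have Cm : 0 <= C / (m - a0) by rewrite divr_ge0// ltW.
have nN1 := ler_norm N1; have nN2 := ler_norm N2.
have n1 := normr_ge0 N1; have n2 := normr_ge0 N2.
have t1 : 1 <= t by rewrite /t; lra.
have tB : B < t by rewrite /t; lra.
have tN1 : N1 < t by rewrite /t; lra.
have tN2 : N2 < t by rewrite /t; lra.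
have tC : C < t * (m - a0).
  by rewrite -ltr_pdivrMr// /t; lra.
have t0 : 0 < t by exact: lt_le_trans t1.
have := key t tB tN1 tN2.
have -> : a0 / t + M / t ^+ 2 = (a0 * t + M) / t ^+ 2 by field; rewrite gt_eqF.
rewrite mulrA ler_pdivlMr ?exprn_gt0// => h.
suff : t * (m - a0) * t ^+ 2 <= C * t ^+ 2.
  by rewrite ler_pM2r ?exprn_gt0// leNgt tC.
have M1 := ler_norm M; have M0 := normr_ge0 M.
have tt : t <= t ^+ 2 by rewrite expr2 ler_peMl// ltW.
have t2 : 1 <= t ^+ 2 by exact: le_trans tt.
have e1 : M * t ^+ 2 <= `|M| * t ^+ 2 by rewrite ler_wpM2r// sqr_ge0.
have e2 : (2 * B * t + 2 * B ^+ 2) * (a0 * t + M) <=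
    (2 * B + 2 * B ^+ 2) * (a0 + `|M|) * t ^+ 2.
  have BB := sqr_ge0 B.
  have -> : (2 * B + 2 * B ^+ 2) * (a0 + `|M|) * t ^+ 2 =
    ((2 * B + 2 * B ^+ 2) * t) * ((a0 + `|M|) * t) by ring.
  have f1 : 2 * B * t + 2 * B ^+ 2 <= (2 * B + 2 * B ^+ 2) * t.
    by rewrite [leRHS]mulrDl lerD2l ler_peMr// mulr_ge0.
  have f2 : a0 * t + M <= (a0 + `|M|) * t.
    by rewrite [leRHS]mulrDl lerD2l (le_trans M1)// ler_peMr.
  have f0 : 0 <= 2 * B * t + 2 * B ^+ 2.
    by rewrite addr_ge0 ?mulr_ge0 ?(ltW B0) ?(ltW t0).
  apply: le_trans (ler_wpM2l f0 f2) _.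
  by apply: ler_wpM2r => //; rewrite mulr_ge0 ?(ltW t0)// addr_ge0 ?(ltW a00).
have -> : t * (m - a0) * t ^+ 2 = m * (t - B) * t ^+ 2 + m * B * t ^+ 2 - a0 * t ^+ 3 by ring.
have -> : C * t ^+ 2 = m * B * t ^+ 2 + `|M| * t ^+ 2 +
  (2 * B + 2 * B ^+ 2) * (a0 + `|M|) * t ^+ 2 by rewrite /C; ring.
have E : ((t + B) ^+ 2 + B ^+ 2) * (a0 * t + M) =
  a0 * t ^+ 3 + M * t ^+ 2 + (2 * B * t + 2 * B ^+ 2) * (a0 * t + M) by ring.
rewrite E in h; move: h e1 e2.
move: (m * (t - B) * t ^+ 2) (m * B * t ^+ 2) (a0 * t ^+ 3) (M * t ^+ 2) (`|M| * t ^+ 2).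
move: ((2 * B * t + 2 * B ^+ 2) * (a0 * t + M)) ((2 * B + 2 * B ^+ 2) * (a0 + `|M|) * t ^+ 2).
by move=> x1 x2 x3 x4 x5 x6 x7 h e1 e2; lra.
Qed.

End OffSupport.

(** * Growth near the compact set L *)

Section GrowthBound.
Variables (R : realType) (P : {poly {poly R[i]}}) (K L : set (plane R)).
Hypotheses (d1 : (1 <= deg_w P)%N) (cK : compact_plane K) (convK : convex_plane K).
Hypotheses (cL : compact_plane L) (hLp : forall z, L z -> (P`_(deg_w P)).[cplx z] != 0).
Implicit Types (z w a : plane R).

Lemma continuous_cabs_horner (q : {poly R[i]}) :
  continuous ((fun z : plane R => cabs q.[cplx z]) : (R * R)%type -> R).
Proof.
apply: local_lipschitz_continuous => z.
have M0 : 0 <= cabs (cplx z) + 2 by rewrite addr_ge0// cabs_ge0.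
have [B [B0 _ BL]] := poly_bounded_lipschitz q M0.
exists B; split=> // w wz.
have wM : cabs (cplx w) <= cabs (cplx z) + 2.
  have := cabs_le_sup_dist w z; have := lerB_cabs (cplx w) (cplx z).
  by move: wz; lra.
have zM : cabs (cplx z) <= cabs (cplx z) + 2 by rewrite lerDl.
apply: le_trans (BL _ _ zM wM).
rewrite ler_norml; apply/andP; split; last exact: lerB_cabs.
by rewrite lerNl opprB cabsBC; exact: lerB_cabs.
Qed.

Lemma coef_bounds_near : exists c B delta : R, [/\ 0 < c, 0 < B, 0 < delta &
  forall a z, L a -> sup_dist z a <= delta ->
    c <= cabs (P`_(deg_w P)).[cplx z] /\ forall j, cabs (P`_j).[cplx z] <= B].
Proof.
have [L0|/set0P L0] := eqVneq L set0.
  by exists 1, 1, 1; split=> // a z; rewrite L0.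
set q := P`_(deg_w P).
have [p [Lp pmin]] := compact_plane_min cL L0 (@continuous_cabs_horner q).
have [N [N0 LN]] := compact_plane_bounded cL.
have N20 : 0 <= N + 2 by rewrite addr_ge0// ltW.
have [B [B0 PB]] := coefs_bounded P N20.
have [Q [Q0 _ QL]] := poly_bounded_lipschitz q N20.
set c := cabs q.[cplx p] / 2.
have c0 : 0 < c by rewrite divr_gt0// cabs_gt0 hLp.
(* [c] is half the minimum of [|p_d|] on [L], and the Lipschitz constant [Q] lets [p_d] vary by at
   most [c] over the sup distance [c/(2Q)]. The entry 1 keeps [z] in the disc of radius [N + 2]. *)
exists c, B, (Num.min 1 (c / (2 * Q))); split=> //.
  by rewrite lt_min ltr01 divr_gt0// mulr_gt0.
move=> a z La; rewrite le_min => /andP[za1 zac].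
have aN := LN a La; have zd := cabs_le_sup_dist z a.
have zN : cabs (cplx z) <= N + 2.
  by have := lerB_cabs (cplx z) (cplx a); lra.
have aN2 : cabs (cplx a) <= N + 2 by lra.
split=> [|j]; last exact: PB.
have h := QL _ _ aN2 zN; have := pmin a La.
have := lerB_cabs q.[cplx a] (q.[cplx a] - q.[cplx z]).
rewrite subKr => h1 h2.
have h3 : Q * cabs (cplx a - cplx z) <= c.
  have Q2 : 0 < 2 * Q by rewrite mulr_gt0.
  move: zac; rewrite ler_pdivlMr// => zac.
  apply: le_trans zac; rewrite cabsBC.
  have -> : sup_dist z a * (2 * Q) = Q * (2 * sup_dist z a) by ring.
  by rewrite ler_pM2l.
have : 2 * c = cabs q.[cplx p] by rewrite /c; field.
by move: h h1 h2 h3; lra.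
Qed.

Variable mu : {finite_measure set (plane R) -> \bar R}.
Variables (f : R[i] -> R[i]) (a0 : R).
Hypotheses (hf : positive_algebraic_germ f a0 P) (germ : germ_measures f K mu).

Let mK : measurable K := compact_plane_measurable cK.

Let density z : R := cabs (eval_zw P (cplx z) (cauchy_transform mu z)) `^ (deg_w P)%:R^-1.

Let measurable_density : measurable_fun setT density.
Proof.
apply: (measurableT_comp (measurable_powR _)).
apply: measurable_cabs; apply: cmeasurable_eval_zw; first exact: cmeasurable_cplx.
exact: cmeasurable_cauchy_transform.
Qed.

Let density_ge0 z : 0 <= density z. Proof. exact: powR_ge0. Qed.

(** The box may leave [K], whereas the defect only integrates over [K]. Off [K] the density is 0,
    the exponent [1/d] being nonzero. *)
Lemma integral_density_box a s :
  (\int[lebesgue2]_(z in box a s) (density z)%:E <= defect P K mu)%E.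
Proof.
have mB := measurable_box a s.
have mE : measurable_fun setT (fun z => (density z)%:E) by exact/measurable_EFinP.
have -> : (\int[lebesgue2]_(z in box a s) (density z)%:E =
    \int[lebesgue2]_(z in box a s `&` K) (density z)%:E)%E.
  rewrite [RHS]integral_mkcondr; apply: eq_integral => z _.
  rewrite patchE; case: ifPn => //; rewrite notin_setE => nKz.
  case: hf => _ _ _ Pf.
  rewrite /density (eval_cauchy_transform_off_support cK convK germ Pf nKz).
  by rewrite cabs0 powR0// invr_eq0 pnatr_eq0 -lt0n.
have -> : defect P K mu = (\int[lebesgue2]_(z in K) (density z)%:E)%E by [].
apply: ge0_subset_integral => //; first exact: measurableI.
  exact: measurable_funTS.
by move=> z _; rewrite lee_fin.
Qed.

(** With [s = 4r] the prefactor [8/s] is [2/r] and the box has area [64 r^2], whence 128 and 2. *)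
Lemma mass_le_defect a (r A : R) : 0 < r -> 0 < A ->
  (forall z, box a (4 * r) z -> cabs (cauchy_transform mu z) <= A * (1 + density z)) ->
  (mu (disc a r) <= (128 * A * r)%:E + (2 * A / r)%:E * defect P K mu)%E.
Proof.
move=> r0 A0 CA; have s0 : 0 < 4 * r by rewrite mulr_gt0.
have := mass_le_integral_cauchy_transform a s0 mu.
rewrite [4 * r / 4](_ : _ = r); last by field.
move=> /le_trans; apply.
have mB := measurable_box a (4 * r).
have mE : measurable_fun setT (fun z => (density z)%:E) by exact/measurable_EFinP.
apply: (@le_trans _ _ ((8 / (4 * r))%:E *
    \int[lebesgue2]_(z in box a (4 * r)) (A%:E * (1 + (density z)%:E)))%E).
  rewrite lee_wpmul2l ?lee_fin ?divr_ge0 ?(ltW s0)//.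
  apply: ge0_le_integral => //.
  - by move=> z _; rewrite lee_fin cabs_ge0.
  - apply: measurable_funTS; apply/measurable_EFinP; apply: measurable_cabs.
    exact: cmeasurable_cauchy_transform.
  - apply: measurable_funeM; apply: emeasurable_funD => //; exact: measurable_funTS.
rewrite ge0_integralZl//; last 3 first.
- apply: emeasurable_funD => //; exact: measurable_funTS.
- by move=> z _; rewrite adde_ge0// lee_fin.
- by rewrite lee_fin ltW.
rewrite ge0_integralD//; last 2 first.
- by move=> z _; rewrite lee_fin.
- exact: measurable_funTS.
rewrite integral_cst// mul1e.
rewrite [X in (_ * (_ * (X + _)))%E](lebesgue_box a (ltW s0)).
have -> : (128 * A * r = 8 / (4 * r) * A * (4 * (4 * r) ^+ 2))%R by field; rewrite gt_eqF.
have -> : (2 * A / r = 8 / (4 * r) * A)%R by field; rewrite gt_eqF.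
have k0 : (0 <= (8 / (4 * r) * A)%:E)%E.
  by rewrite lee_fin mulr_ge0 ?divr_ge0 ?(ltW s0) ?(ltW A0).
rewrite muleA -EFinM ge0_muleDr; last 2 first.
- by rewrite lee_fin mulr_ge0// sqr_ge0.
- by apply: integral_ge0 => z _; rewrite lee_fin.
rewrite -EFinM leeD2l// lee_wpmul2l//; exact: integral_density_box.
Qed.

End GrowthBound.

(** * Atoms and the final choice of constants *)

Section Atoms.
Variables (R : realType) (mu : {finite_measure set (plane R) -> \bar R}).

Lemma measurable_point (a : plane R) : measurable [set a].
Proof. by apply: compact_plane_measurable; exact: compact_set1. Qed.

Lemma mass_point_le_disc (a : plane R) (r : R) : 0 < r ->
  (mu [set a] <= mu (disc a r))%E.
Proof.
move=> r0; apply: le_measure; rewrite ?inE.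
- exact: measurable_point.
- exact: measurable_disc.
- by move=> _ ->; rewrite /disc /= subrr cabs0.
Qed.

Lemma mass_point0 (a : plane R) (C r0 : R) : 0 < C -> 0 < r0 ->
  (forall r, 0 < r <= r0 -> (mu (disc a r) <= (C * r)%:E)%E) -> mu [set a] = 0%E.
Proof.
move=> C0 r00 growth.
have fm : mu [set a] \is a fin_num by rewrite fin_num_measure//; exact: measurable_point.
rewrite -(fineK fm); congr EFin; apply/eqP; rewrite eq_le fine_ge0// andbT.
rewrite leNgt; apply/negP => m0; set m := fine _ in m0.
pose r := Num.min r0 (m / (2 * C)).
have C2 : 0 < 2 * C by rewrite mulr_gt0.
have rp : 0 < r by rewrite lt_min r00 divr_gt0.
have rr : 0 < r <= r0 by rewrite rp ge_min lexx.
have rm : r * (2 * C) <= m by rewrite -ler_pdivlMr// ge_min lexx orbT.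
have := le_trans (mass_point_le_disc a rp) (growth r rr).
rewrite -(fineK fm) lee_fin -/m => h.
by move: h rm m0; rewrite [r * _](_ : _ = 2 * (C * r)); [lra | ring].
Qed.

End Atoms.

(** The growth bound at radius [t m]: its linear term is at most [m/2] and is absorbed on the left,
    so the defect term must carry the other half of [m]. *)
Lemma quadratic_lower_bound (R : realType) (m t C1 C2 : R) (D : \bar R) :
  0 < m -> 0 < t -> 0 < C2 -> C1 * t <= 2^-1 -> (0 <= D)%E ->
  (m%:E <= (C1 * (t * m))%:E + (C2 / (t * m))%:E * D)%E ->
  ((t / (2 * C2) * m ^+ 2)%:E <= D)%E.
Proof.
move=> m0 t0 C20 C1t; case: D => [x| |] // x0; last by rewrite leey.
rewrite -EFinM -EFinD !lee_fin => h.
have h1 : C1 * (t * m) <= 2^-1 * m by rewrite mulrA ler_wpM2r// ltW.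
have h2 : 2^-1 * m <= C2 / (t * m) * x by lra.
have tm : 0 < t * m by rewrite mulr_gt0.
move: h2; rewrite mulrAC ler_pdivlMr// => h2.
rewrite mulrAC ler_pdivrMr ?mulr_gt0//.
have -> : t * m ^+ 2 = 2 * (2^-1 * m * (t * m)) by field.
have -> : x * (2 * C2) = 2 * (C2 * x) by ring.
by rewrite ler_pM2l.
Qed.

Lemma growth_near (R : realType) (P : {poly {poly R[i]}}) (K L : set (plane R)) :
  (1 <= deg_w P)%N -> compact_plane K -> convex_plane K -> compact_plane L ->
  (forall z, L z -> (P`_(deg_w P)).[cplx z] != 0) ->
  exists C1 C2 r0 : R, [/\ 0 < C1, 0 < C2, 0 < r0 &
    forall (f : R[i] -> R[i]) (a0 : R)
        (mu : {finite_measure set (plane R) -> \bar R}),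
      positive_algebraic_germ f a0 P -> germ_measures f K mu ->
      forall (a : plane R) (r : R), L a -> 0 < r <= r0 ->
        (mu (disc a r) <= (C1 * r)%:E + (C2 / r)%:E * defect P K mu)%E].
Proof.
move=> d1 cK convK cL hLp.
have [c [B [delta [c0 B0 delta0 coefs]]]] := coef_bounds_near cL hLp.
pose A := 1 + 2 * (deg_w P)%:R * B / c + 2 / c.
have A0 : 0 < A.
  by rewrite !addr_gt0 ?divr_gt0 ?mulr_gt0 ?ltr0n.
(* The radius is a quarter of [delta] because the box used has half-side [4r]. All three constants
   are fixed before [f] and [mu] are introduced. *)
exists (128 * A), (2 * A), (delta / 4); split; rewrite ?mulr_gt0 ?divr_gt0//.
move=> f a0 mu hf germ a r La /andP[r0 rd].
apply: (mass_le_defect d1 cK convK hf germ r0 A0) => z /boxP za.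
have [|cz Bz] := coefs a z La; first by apply: le_trans za _; lra.
exact: root_power_bound.
Qed.

Unset Implicit Arguments.

Theorem theorem2 (R : realType) (P : {poly {poly R[i]}}) (K L : set (plane R))
    (hP : irreducible_zw P) (hd : (1 <= deg_w P)%N)
    (hK : compact_plane K) (hKconv : convex_plane K)
    (hL : compact_plane L)
    (hLp : forall z, L z -> (P`_(deg_w P)).[cplx z] != 0) :
  (exists C1 C2 r0 : R, [/\ 0 < C1, 0 < C2, 0 < r0 &
    forall (f : R[i] -> R[i]) (a0 : R)
        (mu : {finite_measure set (plane R) -> \bar R}),
      positive_algebraic_germ f a0 P -> germ_measures f K mu ->
      (forall (a : plane R) (r : R), L a -> 0 < r <= r0 ->
         (mu (disc a r) <= (C1 * r)%:E + (C2 / r)%:E * defect P K mu)%E) /\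
      (defect P K mu = 0%E ->
         (forall (a : plane R) (r : R), L a -> 0 < r <= r0 ->
            (mu (disc a r) <= (C1 * r)%:E)%E) /\
         (forall a : plane R, L a -> mu [set a] = 0%E))]) /\
  (forall a0 : R, 0 < a0 -> exists c_at : R, 0 < c_at /\
    forall (f : R[i] -> R[i])
        (mu : {finite_measure set (plane R) -> \bar R}) (a : plane R) (m : R),
      positive_algebraic_germ f a0 P -> germ_measures f K mu ->
      L a -> 0 < m -> mu [set a] = m%:E ->
      ((c_at * m ^+ 2)%:E <= defect P K mu)%E).
Proof.
have [C1 [C2 [r0 [C10 C20 r00 growth]]]] := growth_near hd hK hKconv hL hLp.
split.
  exists C1, C2, r0; split=> // f a0 mu hf germ.
  have bound := growth f a0 mu hf germ; split=> // D0.
  have linear a r : L a -> 0 < r <= r0 -> (mu (disc a r) <= (C1 * r)%:E)%E.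
    by move=> La rr; have := bound a r La rr; rewrite D0 mule0 adde0.
  by split=> // a La; apply: (mass_point0 C10 r00) => r; exact: linear.
move=> a0 a00.
(* The first entry makes the radius [t m] admissible for every [m <= a0]; the second makes the
   linear term absorbable. *)
pose t := Num.min (r0 / a0) (2^-1 / C1).
have t0 : 0 < t by rewrite lt_min !divr_gt0.
have t1 : C1 * t <= 2^-1 by rewrite mulrC -ler_pdivlMr// ge_min lexx orbT.
exists (t / (2 * C2)); split; first by rewrite divr_gt0// mulr_gt0.
move=> f mu a m hf germ La m0 ma.
have ma0 : m <= a0.
  case: hf => _ _ lead _.
  apply: le_trans (mass_le_leading_coef hK germ a00 lead).
  have fT : mu setT \is a fin_num by rewrite fin_num_measure.
  rewrite -lee_fin fineK// -ma; apply: le_measure; rewrite ?inE//.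
  exact: measurable_point.
have tm0 : 0 < t * m by rewrite mulr_gt0.
have tm : 0 < t * m <= r0.
  rewrite tm0 (@le_trans _ _ (t * a0))//; first by rewrite ler_wpM2l// ltW.
  by rewrite -ler_pdivlMr// ge_min lexx.
apply: (quadratic_lower_bound m0 t0 C20 t1).
  by apply: integral_ge0 => z _; rewrite lee_fin powR_ge0.
rewrite -ma; apply: le_trans (mass_point_le_disc mu a tm0) _.
exact: growth hf germ _ _ La tm.
Qed.
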